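(* Let $1<\lambda<\sqrt2$, and let $\mathcal{E}_M$ be a sequence of energies with $\lim_{M\to\infty}\mathcal{E}_M=-1$ for which the limit $$\tau=\lim_{M\to\infty}\left[\widehat{\mathcal{E}}_M^{(-1)}-\mathcal{E}_M\right]/\Delta_M$$ exists in $\mathbb{R}$. Then, within the scaling windows centered at $\mathcal{E}_M$, with probability tending to $1$ there is a (random) eigenvalue $u_{M,n_M}$ such that: (1) $u_{M,n_M}=\tau+o(1)$ (i.e. $u_{M,n_M}\to\tau$ in probability) and the corresponding eigenfunction is $\ell^2$-delocalized: for any $\gamma>0$ $$\lim_{M\to\infty}\mathbb{P}\left(\frac{\|\psi_{M,n_M}\|_2}{\|\psi_{M,n_M}\|_\infty}\ge M^{\frac1{\lambda^2}-\frac12-\gamma}\right)=1;$$ (2) all other eigenfunctions in the scaling window are $\ell^2$-localized: for each $W<\infty$ and $\gamma>0$ $$\lim_{M\to\infty}\mathbb{P}\left(\max_{n\ne n_M:\ |u_{M,n}|<W}\frac{\|\psi_{M,n}\|_2}{\|\psi_{M,n}\|_\infty}\le1+\frac1{M^{\frac1{\lambda^2}-\frac12-\gamma}}\right)=1 .$$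
   Context: Operator. For $M\ge2$ and $\lambda>0$, $\kappa_M:=\lambda/\sqrt{2\ln M}$ and $H_M:=-|\varphi_0\rangle\langle\varphi_0|+\kappa_M V$ is the random $M\times M$ matrix in which $\varphi_0=(1,\dots,1)/\sqrt{M}$ and $V$ is the diagonal matrix with i.i.d. standard Gaussian entries $V(1),\dots,V(M)$, with density $\varrho(v)=e^{-v^2/2}/\sqrt{2\pi}$. Scaling. $\Delta_M(\mathcal{E}):=\kappa_M/(M\varrho(\mathcal{E}/\kappa_M))=\sqrt{2\pi}\,\kappa_M/M^{1-(\mathcal{E}/\lambda)^2}$. For a given sequence $\mathcal{E}_M$ put $\Delta_M:=\Delta_M(\mathcal{E}_M)$. The rescaled potential values are the numbers $(\kappa_M V(x)-\mathcal{E}_M)/\Delta_M$, $x=1,\dots,M$, labeled in increasing order as $\dots\le\omega_{M,-1}\le\omega_{M,0}\le0<\omega_{M,1}<\dots$, with $x_m$ denoting the site corresponding to $\omega_{M,m}$. The rescaled eigenvalues are the numbers $(E-\mathcal{E}_M)/\Delta_M$ with $E$ an eigenvalue of $H_M$; almost surely they are simple and interlace with the $\omega_{M,n}$, and are labeled so that $\omega_{M,n-1}<u_{M,n}\le\omega_{M,n}$. The eigenfunction for $u_{M,n}$ is normalized as $\psi_{M,n}(x_m)=1/(\omega_{M,m}-u_{M,n})$. $\|\cdot\|_p$ is the $\ell^p$ norm over the $M$ sites. Reference energy. $\widehat{\varrho}_M(\mathcal{E}):=\mathrm{p.v.}\!\int\frac{\varrho(v)\,dv}{\kappa_M v-\mathcal{E}}$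 (principal value). For large $M$ the equation $\widehat{\varrho}_M(\mathcal{E})=1$ has exactly one solution in the vicinity of $-1$; it is denoted $\widehat{\mathcal{E}}_M^{(-1)}$, and it tends to $-1$ as $M\to\infty$. *)

(* Defs.v *)
From HB Require Import structures.
From mathcomp Require Import all_boot all_order all_algebra.
From mathcomp Require Import all_classical all_reals all_analysis.

Set Implicit Arguments.
Unset Strict Implicit.
Unset Printing Implicit Defensive.

Import Order.TTheory GRing.Theory Num.Theory.
Import numFieldNormedType.Exports.

Local Open Scope classical_set_scope.
Local Open Scope ring_scope.

(* A measure of MathComp-Analysis takes unspecified values on non-measurable
   sets.  Probabilities of events are therefore read as inner probabilities,
   which agree with P on measurable sets (inner_probE) and do not depend on
   what happens on null sets, where eigenvalues may fail to be simple. *)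
Definition inner_prob (R : realType) (d : measure_display)
    (T : measurableType d) (P : probability T R) (A : set T) : \bar R :=
  ereal_sup [set P B | B in [set B | measurable B /\ B `<=` A]].

Lemma inner_probE (R : realType) (d : measure_display)
    (T : measurableType d) (P : probability T R) (A : set T) :
  measurable A -> inner_prob P A = P A.
Proof.
move=> mA; apply/eqP; rewrite eq_le; apply/andP; split.
- by apply: ge_ereal_sup => _ [B [mB BA] <-]; apply: le_measure; rewrite ?inE.
- by apply: ereal_sup_ubound; exists A => //; split.
Qed.

Definition whp (R : realType) (d : nat -> measure_display)
    (T : forall M, measurableType (d M)) (P : forall M, probability (T M) R)
    (A : forall M, set (T M)) : Prop :=
  inner_prob (P M) (A M) @[M --> \oo] --> 1%E.

(* Mutual independence: the product rule for the whole finite family suffices,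
   since any of the sets may be taken to be setT. *)
Definition mutually_independent (R : realType) (d : measure_display)
    (T : measurableType d) (P : probability T R) (I : finType)
    (X : I -> {RV P >-> R}) : Prop :=
  forall B : I -> set R, (forall i, measurable (B i)) ->
    P (\bigcap_(i in [set: I]) X i @^-1` B i) =
    (\prod_(i : I) P (X i @^-1` B i))%E.

Definition iid_std_gaussian (R : realType) (d : measure_display)
    (T : measurableType d) (P : probability T R) (I : finType)
    (X : I -> {RV P >-> R}) : Prop :=
  mutually_independent X /\
  forall (i : I) (B : set R), measurable B ->
    distribution P (X i) B = normal_prob 0 1 B.

Section Operator.
Context {R : realType}.
Implicit Types (M : nat) (lam E u a : R).

Definition rho (v : R) : R := expR (- v ^+ 2 / 2) / Num.sqrt (2 * pi).

Lemma rho_normal_pdf (v : R) : rho v = normal_pdf 0 1 v.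
Proof.
rewrite /rho normal_pdfE ?oner_eq0// /normal_peak /normal_fun.
by rewrite subr0 expr1n mul1r mulrC -(mulr_natl pi).
Qed.

Definition kappa lam M : R := lam / Num.sqrt (2 * ln M%:R).

Definition Delta lam M E : R := kappa lam M / (M%:R * rho (E / kappa lam M)).

Definition phi0 M : 'cV[R]_M := const_mx (Num.sqrt M%:R)^-1.

Definition Hmx lam M (v : 'I_M -> R) : 'M[R]_M :=
  - (phi0 M *m (phi0 M)^T) + kappa lam M *: diag_mx (\row_x v x).

Definition rescale lam M E a : R := (a - E) / Delta lam M E.

Definition site_omega lam M E (v : 'I_M -> R) (x : 'I_M) : R :=
  rescale lam M E (kappa lam M * v x).

Definition sorted_omega lam M E (v : 'I_M -> R) : seq R :=
  sort <=%R [seq site_omega lam E v x | x <- enum 'I_M].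

Definition omega lam M E (v : 'I_M -> R) (m : int) : \bar R :=
  (* omega_0 is the largest nonpositive value; labels below (above) the range
     of the M values stand for -oo (+oo), so that the lowest eigenvalue, which
     lies below every omega, gets a label too *)
  let s := sorted_omega lam E v in
  let k := count (fun y => y <= 0) s in
  match (m + k%:Z - 1)%R with
  | Posz i => if (i < M)%N then (s`_i)%:E else +oo%E
  | Negz _ => -oo%E
  end.

Definition has_label lam M E (v : 'I_M -> R) (n : int) u : Prop :=
  (exists2 e : R, eigenvalue (Hmx lam v) e & u = rescale lam M E e) /\
  (omega lam E v (n - 1) < u%:E)%E /\ (u%:E <= omega lam E v n)%E.

Definition labelled lam M E (v : 'I_M -> R) (n : int) : Prop :=
  exists u, has_label lam E v n u.

(* u_n; almost surely at most one eigenvalue carries the label n.  The value 0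
   is returned when there is none, so uses must be guarded by labelled. *)
Definition eig lam M E (v : 'I_M -> R) (n : int) : R :=
  xget 0 [set u | has_label lam E v n u].

(* Indexed by the site x = x_m itself rather than by m; x_m is the site whose
   rescaled potential site_omega is omega_m. *)
Definition psi lam M E (v : 'I_M -> R) (n : int) (x : 'I_M) : R :=
  1 / (site_omega lam E v x - eig lam E v n).

Definition l2norm M (f : 'I_M -> R) : R := Num.sqrt (\sum_x `|f x| ^+ 2).

Definition linfnorm M (f : 'I_M -> R) : R := \big[Num.max/0]_x `|f x|.

Definition norm_ratio lam M E (v : 'I_M -> R) (n : int) : R :=
  l2norm (psi lam E v n) / linfnorm (psi lam E v n).

Definition rho_hat lam M E : R :=
  lim ((\int[@lebesgue_measure R]_(v in
          [set v : R | eps < `|v - E / kappa lam M|])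
        (rho v / (kappa lam M * v - E))) @[eps --> 0^'+]).

(* The solution of rho_hat = 1 near -1 is unique only for large M, so it is
   described as a sequence: any two sequences as below eventually coincide. *)
Definition reference_energy lam (Ehat : nat -> R) : Prop :=
  (\forall M \near \oo, rho_hat lam M (Ehat M) = 1) /\
  Ehat M @[M --> \oo] --> (-1 : R).

End Operator.

(* Main.v *)
(** Substituting [u = t + tauM], with [tauM] the rescaled distance from [E] to
    the reference energy, the eigenvalue equation becomes
    [\sum_x 1 / (z_x - t) = M Delta], where [z_x] is the rescaled potential seen
    from the reference energy.  The sites at macroscopic distance contribute
    [M Delta + c t M Delta^2] up to a law of large numbers error of order
    [sqrt(M) Delta], the equation [rho_hat = 1] being what makes the constant
    term equal to [M Delta].  Since [lam < sqrt 2], [M Delta^2] is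
    [M^(2 beta + o(1))] with [beta = 1 / lam^2 - 1 / 2 > 0]; it dominates the
    law of large numbers error, which is [M^(beta + o(1))], and the
    contribution [M^o(1)] of the sites near the reference energy that are not
    extremely close to [t].  Hence either [t] is close to [0], which gives the
    root carrying the bulk [\ell^2] mass [M Delta^2], or [t] is at distance at
    most of order [1 / (M Delta^2)] from a single [z_x], and the eigenfunction
    is localized there.  All estimates are made up to factors [M^eta] with
    [eta] arbitrarily small, so that no sharp bound on the density of the [z_x]
    is ever needed. *)

Require Import Defs.
From HB Require Import structures.
From mathcomp Require Import all_boot all_order all_algebra.
From mathcomp Require Import ring lra.
From mathcomp Require Import all_classical all_reals all_analysis.
From mathcomp Require Import measurable_realfun.

Import Order.TTheory GRing.Theory Num.Theory.
Import numFieldNormedType.Exports.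

Local Open Scope classical_set_scope.
Local Open Scope ring_scope.

(** * The secular equation *)

Section SecularEquation.
Context {R : realType}.
Implicit Types (lam e : R).

(** Randomness enters only once: off a measurable bad event finitely many inequalities hold, and
    from them the root, its label and both norm bounds follow deterministically, for all [t] in the
    window at the same time. With [A = M^eta], a unit of rescaled potential near the reference
    energy carries at most [A] expected sites. Demanding separation [delta = A^-3], between two
    sites or from the reference energy, thus costs probability of order at most [1 / A], and a
    Markov bound on the near sum loses only powers of [A]. The slope gains [B^2] up to such powers,
    where [B = M^beta], so every loss is absorbed once [20 eta <= beta]. The condition [1 < lam]
    means [2 beta < 1], which makes [Delta] tend to 0, so that the window is microscopic. The index
    is not found by selecting an eigenvalue. It is the label of the gap containing the deterministic
    point [tauM], hence measurable. On the good event no site comes within [2 delta] of that point,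
    so the root within [delta] of it carries this label, and a root with another label is at
    distance at least [2 delta]. *)

Lemma Hmx_entry lam M (v : 'I_M -> R) i j : (0 < M)%N ->
  Hmx lam v i j = - M%:R^-1 + (kappa lam M * v i) *+ (i == j).
Proof.
move=> M0; rewrite /Hmx !mxE big_ord1 !mxE -invfM -expr2 sqr_sqrtr ?ler0n//.
by rewrite mulrnAr.
Qed.

Lemma mul_row_Hmx lam M (v : 'I_M -> R) (f : 'rV[R]_M) j : (0 < M)%N ->
  (f *m Hmx lam v) 0 j =
  - (M%:R^-1 * \sum_x f 0 x) + kappa lam M * v j * f 0 j.
Proof.
move=> M0; rewrite mxE (eq_bigr (fun x =>
    - M%:R^-1 * f 0 x + (kappa lam M * v x * f 0 x) *+ (x == j))); last first.
  by move=> x _; rewrite Hmx_entry// mulrDr mulrC mulrnAr [f 0 x * _]mulrC.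
rewrite big_split/= -mulr_sumr mulNr; congr (_ + _).
rewrite (bigD1 j)//= eqxx big1 ?addr0// => i /negbTE ->.
by [].
Qed.

(** The row with entries [1 / (kappa * v x - e)] is an eigenvector: its entries sum to [M], so the
    rank-one part subtracts exactly 1 from each [kappa * v x / (kappa * v x - e)]. *)
Lemma secular_eigenvalue lam M (v : 'I_M -> R) e : (0 < M)%N ->
  (forall x, kappa lam M * v x != e) ->
  \sum_x (kappa lam M * v x - e)^-1 = M%:R -> eigenvalue (Hmx lam v) e.
Proof.
move=> M0 ve sM; apply/eigenvalueP.
exists (\row_x (kappa lam M * v x - e)^-1).
  apply/rowP => j; rewrite mul_row_Hmx// !mxE.
  under eq_bigr do rewrite mxE.
  rewrite sM mulVf ?pnatr_eq0 -?lt0n//.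
  have : kappa lam M * v j - e != 0 by rewrite subr_eq0.
  by move: (kappa lam M * v j) => k k0; field.
apply/eqP => /rowP /(_ (Ordinal M0)); rewrite !mxE.
by apply/eqP; rewrite invr_eq0 subr_eq0.
Qed.

(** Injectivity excludes eigenvectors orthogonal to [phi0]: if the entries summed to 0, the vector
    would live on the single site with [kappa * v x = e], and the sum would be its only nonzero
    entry. *)
Lemma eigenvalue_secular lam M (v : 'I_M -> R) e : (0 < M)%N ->
  injective (fun x => kappa lam M * v x) -> eigenvalue (Hmx lam v) e ->
  (forall x, kappa lam M * v x != e) /\
  \sum_x (kappa lam M * v x - e)^-1 = M%:R.
Proof.
move=> M0 vi /eigenvalueP[f fH f0].
have Mr0 : M%:R != 0 :> R by rewrite pnatr_eq0 -lt0n.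
have fE j : (kappa lam M * v j - e) * f 0 j = M%:R^-1 * \sum_x f 0 x.
  have /rowP/(_ j) := fH; rewrite mul_row_Hmx// !mxE.
  by move=> H; rewrite mulrBl -H; ring.
set s := \sum_x f 0 x in fE.
have s0 : s != 0.
  apply/eqP => s0; rewrite s0 mulr0 in fE.
  have [j fj] : exists j, f 0 j != 0.
    apply/existsP; apply: contra_neqT f0; rewrite negb_exists => /forallP f0.
    by apply/rowP => j; rewrite mxE; apply/eqP; rewrite -[_ == _]negbK.
  have vj : kappa lam M * v j = e.
    by move/eqP: (fE j); rewrite mulf_eq0 (negbTE fj) orbF subr_eq0 => /eqP.
  move: s0; rewrite /s (bigD1 j)//= big1 ?addr0 => [fj0|i ij].
    by rewrite fj0 eqxx in fj.
  move/eqP: (fE i); rewrite mulf_eq0 -vj subr_eq0 => /orP[/eqP/vi ji|/eqP//].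
  by rewrite ji eqxx in ij.
have ve x : kappa lam M * v x != e.
  apply/eqP => xe; move/eqP: (fE x); rewrite xe subrr mul0r eq_sym mulf_eq0.
  by rewrite invr_eq0 (negbTE Mr0) (negbTE s0).
split=> //; apply: (mulfI s0); rewrite mulr_sumr.
transitivity (M%:R * s); last by rewrite mulrC.
have -> : M%:R * s = \sum_x M%:R * f 0 x by rewrite -mulr_sumr.
apply: eq_bigr => x _.
have vx : kappa lam M * v x - e != 0 by rewrite subr_eq0.
apply: (mulfI vx); rewrite mulrCA divff// mulr1 mulrCA fE.
by rewrite mulrA divff// mul1r.
Qed.

End SecularEquation.

(** * Labels *)

Section Labels.
Context {R : realType}.

Lemma sorted_count_lt (s : seq R) (t : R) (i : nat) : sorted <=%R s ->
  (i < size s)%N -> (s`_i < t) = (i < count (fun y => (y < t)%R) s)%N.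
Proof.
elim: s i => [|a s IH] i //= ps; have ss := path_sorted ps.
case: i => [|i] /=.
  move=> _; case: (ltP a t) => [_|ta]; first by [].
  rewrite add0n; apply/esym/negbTE; rewrite -leqNgt leqn0; apply/eqP.
  apply/eqP; rewrite -leqn0 leqNgt -has_count; apply/hasPn => y ys.
  rewrite -leNgt (le_trans ta)//.
  by move: ps; rewrite (path_sortedE le_trans) => /andP[/allP/(_ _ ys)].
rewrite ltnS => isz; rewrite IH//; case: (ltP a t) => [_|ta]; first by rewrite ltnS.
rewrite add0n; have c0 : count (fun y => y < t) s = 0%N.
  apply/eqP; rewrite -leqn0 leqNgt -has_count; apply/hasPn => y ys.
  rewrite -leNgt (le_trans ta)//.
  by move: ps; rewrite (path_sortedE le_trans) => /andP[/allP/(_ _ ys)].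
by rewrite c0 !ltn0.
Qed.

Definition count_below lam M (E : R) (v : 'I_M -> R) (t : R) : nat :=
  count (fun x => site_omega lam E v x < t) (enum 'I_M).

Definition count_nonpos lam M (E : R) (v : 'I_M -> R) : nat :=
  count (fun x => site_omega lam E v x <= 0) (enum 'I_M).

(** Replaces the sorted list by two counts. The label then makes sense at any real point and is
    unique, and its measurability reduces to that of counts. *)
Lemma omega_gapP lam M (E : R) (v : 'I_M -> R) (n : int) (u : R) :
  (omega lam E v (n - 1) < u%:E)%E /\ (u%:E <= omega lam E v n)%E <->
  n = (count_below lam M E v u)%:Z - (count_nonpos lam M E v)%:Z + 1.
Proof.
have szs : size (sorted_omega lam E v) = M.
  by rewrite size_sort size_map size_enum_ord.
have srt : sorted <=%R (sorted_omega lam E v).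
  by apply: sort_sorted; exact: le_total.
have cE (p : pred R) : count p (sorted_omega lam E v) =
    count (fun x => p (site_omega lam E v x)) (enum 'I_M).
  rewrite /sorted_omega (permP (permEl (perm_sort _ _))) count_map.
  exact: eq_count.
have cM : (count_below lam M E v u <= M)%N.
  by rewrite (leq_trans (count_size _ _))// size_enum_ord.
have := sorted_count_lt _ u _ srt.
rewrite szs cE -/(count_below lam M E v u) /omega cE.
rewrite -/(count_nonpos lam M E v).
move: (count_below _ _ _ _ _) (count_nonpos _ _ _ _) cM => c k cM sP.
(* [omega n] sits at zero-based position [n + k - 1]. The entries strictly below [u] fill positions
   [0] to [c - 1], so that position must be [c]; the infinite values cover [c = 0] and [c = M]. *)
have -> : n - 1 + k%:Z - 1 = (n + k%:Z - 1) - 1 by ring.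
have -> : (n = c%:Z - k%:Z + 1) <-> (n + k%:Z - 1 = c%:Z).
  split=> [->|]; first by ring.
  by move=> <-; ring.
move: (n + k%:Z - 1) => {n k} i; split.
- case: i => [i|i]; last by case.
  case: i => [|i].
    case: ltnP => [M0 [_]|]; last first.
      by move=> /(leq_trans cM); rewrite leqn0 => /eqP ->.
    by rewrite lee_fin leNgt sP// lt0n negbK => /eqP ->.
  have -> : i.+1%:Z - 1 = i%:Z by rewrite -addn1 PoszD addrK.
  case: (ltnP i M) => [iM|_ []]; last by rewrite ltNge leey.
  rewrite lte_fin sP// => -[ic].
  case: (ltnP i.+1 M) => [iM'|Mi].
    by rewrite lee_fin leNgt sP// -leqNgt => ci; congr Posz; apply/eqP; rewrite eqn_leq ic ci.
  by move=> _; congr Posz; apply/eqP; rewrite eqn_leq ic (leq_trans cM).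
- move=> -> {i}; split.
    case: c cM sP => [|c] cM sP; first by rewrite /= ltNyr.
    have -> : c.+1%:Z - 1 = c%:Z by rewrite -addn1 PoszD addrK.
    by rewrite cM lte_fin sP.
  case: ltnP => [ltcM|]; last by rewrite leey.
  by rewrite lee_fin leNgt sP// ltnn.
Qed.

Lemma count_below_eq lam M (E : R) (v : 'I_M -> R) (s t : R) : s <= t ->
  (count_below lam M E v s == count_below lam M E v t) =
  [forall x, (site_omega lam E v x < t) ==> (site_omega lam E v x < s)].
Proof.
move=> st; rewrite /count_below.
have -> : count (fun x => site_omega lam E v x < t) (enum 'I_M) =
  (count (fun x => site_omega lam E v x < s)%R (enum 'I_M) +
   count (fun x => (s <= site_omega lam E v x) && (site_omega lam E v x < t))%R
     (enum 'I_M))%N.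
  elim: (enum 'I_M) => //= x r ->; case: (ltP _ s) => [xs|sx] /=.
    by rewrite (lt_le_trans xs st) add0n addnA.
  by rewrite add0n addnCA.
rewrite -[X in X == _]addn0 eqn_add2l eq_sym -leqn0 leqNgt -has_count.
apply/hasPn/forallP => [h x|h x _].
  by have := h x; rewrite mem_enum => /(_ isT); rewrite negb_and -ltNge orbC implybE.
by have := h x; rewrite negb_and -ltNge orbC implybE.
Qed.

End Labels.

(** * Roots of the resolvent equation *)

Section Resolvent.
Context {R : realType} {I : finType} (z : I -> R).

Definition resolvent (t : R) : R := \sum_x (z x - t)^-1.

Lemma continuous_resolvent (t : R) : (forall x, z x != t) ->
  {for t, continuous resolvent}.
Proof.
move=> zt; rewrite /resolvent; elim: (index_enum I) => [|x s IH].
  rewrite (_ : (fun _ => _) = cst 0); first exact: cvg_cst.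
  by apply/funext => u; rewrite big_nil.
rewrite (_ : (fun _ => _) =
    (fun u => (z x - u)^-1 + \sum_(i <- s) (z i - u)^-1)); last first.
  by apply/funext => u; rewrite big_cons.
apply: cvgD => //; apply: cvgV; first by rewrite subr_eq0.
by apply: cvgB; [exact: cvg_cst|exact: cvg_id].
Qed.

(** Between consecutive poles every term of the resolvent strictly increases. Hence at most one
    eigenvalue carries a given label. *)
Lemma resolvent_inj_gap (s t : R) : (forall x, z x != s) ->
  (forall x, z x != t) -> (forall x, (z x < s) = (z x < t)) ->
  (0 < #|I|)%N -> resolvent s = resolvent t -> s = t.
Proof.
wlog: s t / s < t => [H zs zt st I0 E|lt_st zs zt st /card_gt0P[x0 _] E].
  case: (ltgtP s t) => // h; first exact: H.
  by apply/esym/H.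
have lt x : (z x - s)^-1 < (z x - t)^-1.
  have := st x; case: (ltgtP (z x) s) (zs x) => // zxs _;
    case: (ltgtP (z x) t) (zt x) => // zxt _ _.
    by rewrite ltf_nV2 ?negrE ?subr_lt0// ltrD2l ltrN2.
  by rewrite ltf_pV2 ?posrE ?subr_gt0// ltrD2l ltrN2.
suff : resolvent s < resolvent t by rewrite E ltxx.
rewrite /resolvent (bigD1 x0)//= [ltRHS](bigD1 x0)//=.
by apply: ltr_leD => //; apply: ler_sum => x _; exact: ltW.
Qed.

(* [far] collects the sites whose potential is at macroscopic distance from the
   reference energy; their contribution to the resolvent is almost linear in
   [t] with slope at least [m], the contribution of the other sites that are
   not within [delta / 2] of [t] is an error. *)
Variables (far : pred I) (N K1 K2 m T delta S : R).
Hypotheses (delta_gt0 : 0 < delta) (delta_le1 : delta <= 1) (delta_leT : delta <= T).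
Hypothesis farN : `|\sum_(x | far x) (z x)^-1 - N| <= K1.
Hypothesis far_dist : forall x, far x -> 2 * T + 2 <= `|z x|.
Hypothesis far_slope : forall t, `|t| <= T ->
  m <= \sum_(x | far x) (z x * (z x - t))^-1.
Hypothesis near_sum : forall t, `|t| <= T ->
  \sum_(x | ~~ far x && (delta / 2 <= `|z x - t|)) `|z x - t|^-1 <= K2.
Hypothesis far_sqr : forall t, `|t| <= T ->
  \sum_(x | far x) (z x - t) ^- 2 <= S.
Hypothesis K_small : K1 + K2 < delta * m.
Hypothesis z_ge : forall x, 2 * delta <= `|z x|.
Hypothesis z_sep : forall x x', x != x' -> `|z x| <= T + 1 ->
  delta <= `|z x - z x'|.

Let T_gt0 : 0 < T. Proof. exact: lt_le_trans delta_leT. Qed.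

Let far_neq0 x : far x -> z x != 0.
Proof. by move=> /far_dist h; apply/eqP => z0; move: h; rewrite z0 normr0;
  move: T_gt0 delta_gt0 delta_le1 delta_leT K_small => *; lra. Qed.

Let far_dist_t x t : far x -> `|t| <= T -> T + 2 <= `|z x - t|.
Proof.
move=> /far_dist h tT; have := lerB_dist (z x) t; have := T_gt0=> *;
  move: T_gt0 delta_gt0 delta_le1 delta_leT K_small => *; lra.
Qed.

(** The resolvent identity [1/(z-t) = 1/z + t/(z(z-t))], exact and without Taylor remainder: all
    further dependence on [t] goes into the slope. *)
Let far_linear t : `|t| <= T -> \sum_(x | far x) (z x - t)^-1 =
  \sum_(x | far x) (z x)^-1 + t * \sum_(x | far x) (z x * (z x - t))^-1.
Proof.
move=> tT; rewrite mulr_sumr -big_split/=; apply: eq_bigr => x fx.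
have z0 := far_neq0 _ fx.
have zt : z x - t != 0.
  by rewrite -normr_eq0 gt_eqF// (lt_le_trans _ (far_dist_t _ _ fx tT))//;
    move: T_gt0 delta_gt0 delta_le1 delta_leT K_small => *; lra.
by field; rewrite z0 zt.
Qed.

(** The predicate [a] is left free because the estimate serves both with all near sites and with the
    one site close to [t] removed. *)
Let error_bound t (a : pred I) : `|t| <= T ->
  (forall x, a x -> ~~ far x && (delta / 2 <= `|z x - t|)) ->
  `|\sum_(x | far x) (z x - t)^-1 + \sum_(x | a x) (z x - t)^-1 - N
    - t * \sum_(x | far x) (z x * (z x - t))^-1| <= K1 + K2.
Proof.
move=> tT aP; rewrite far_linear//.
set F := \sum_(x | _) (z x)^-1; set L := t * _; set A := \sum_(x | a x) _.
have -> : F + L + A - N - L = (F - N) + A by ring.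
rewrite (le_trans (ler_normD _ _))// lerD//.
rewrite (le_trans (ler_norm_sum _ _ _))//.
rewrite (le_trans _ (near_sum _ tT))//.
rewrite big_mkcond [leRHS]big_mkcond/=; apply: ler_sum => x _.
case: ifPn => [/aP->|_]; first by rewrite normfV.
by case: ifP.
Qed.

Let splitG t : resolvent t = \sum_(x | far x) (z x - t)^-1 +
   \sum_(x | ~~ far x) (z x - t)^-1.
Proof. by rewrite /resolvent (bigID far). Qed.

Let off_delta t x : `|t| <= delta -> delta <= `|z x - t|.
Proof. move=> td; have := lerB_dist (z x) t; have := z_ge x;
  move: T_gt0 delta_gt0 delta_le1 delta_leT K_small => *; lra. Qed.

(** At [t = delta] and [t = - delta] the linear term has absolute value at least [delta * m], more
    than the total error, so its sign decides. *)
Lemma resolvent_delta_bounds :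
  resolvent (- delta) < N /\ N < resolvent delta.
Proof.
have e1 t : `|t| = delta ->
    `|resolvent t - N - t * \sum_(x | far x) (z x * (z x - t))^-1|
    <= K1 + K2.
  move=> td; rewrite splitG; apply: error_bound => [|x fx]; first by rewrite td.
  rewrite fx/= (le_trans _ (off_delta _ x _)) ?td//;
    move: T_gt0 delta_gt0 delta_le1 delta_leT K_small => *; lra.
have d1 : `|delta| = delta by rewrite gtr0_norm.
have d2 : `|- delta| = delta by rewrite normrN.
have slope t : `|t| = delta ->
    delta * m <= delta * \sum_(x | far x) (z x * (z x - t))^-1.
  by move=> td; rewrite ler_pM2l// far_slope// td.
split; [have := e1 _ d2; have := slope _ d2|have := e1 _ d1; have := slope _ d1];
  rewrite ler_norml => h /andP[h1 h2]; move: h h1 h2; set D := \sum_(x | _) _;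
  rewrite ?mulNr; move: delta_gt0 K_small => *; lra.
Qed.

(** Intermediate values: by [z_ge] the interval contains no pole. *)
Lemma resolvent_root : exists2 t, `|t| <= delta & resolvent t = N.
Proof.
have [lo hi] := resolvent_delta_bounds.
have [|||t] := @IVT R resolvent (- delta) delta N.
- by move: delta_gt0 => *; lra.
- apply: continuous_in_subspaceT => t.
  rewrite inE/= in_itv/= => td; apply: continuous_resolvent => x.
  have := off_delta t x; rewrite ler_norml td => /(_ isT) h.
  by rewrite -subr_eq0 -normr_eq0 gt_eqF// (lt_le_trans _ h).
- by rewrite ge_min (ltW lo) le_max (ltW hi) orbT.
by rewrite in_itv/= -ler_norml => tT <-; exists t.
Qed.

(** Here the linear term is at least [2 * (delta * m)] while the errors stay below [delta * m]. At a
    root the excess must be cancelled by a site extremely close to [t], and separation allows only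
    one. *)
Lemma resolvent_localized t : `|t| <= T -> 2 * delta <= `|t| ->
  (forall x, z x != t) -> resolvent t = N ->
  exists2 a, delta * m <= `|z a - t|^-1 &
    \sum_(x | x != a) (z x - t) ^- 2 <= S + K2 ^+ 2.
Proof.
move=> tT td zt Gt.
have slope : 2 * (delta * m) <=
    `|t * \sum_(x | far x) (z x * (z x - t))^-1|.
  have m0 : 0 <= m.
    rewrite -(pmulr_rge0 _ delta_gt0) (le_trans _ (ltW K_small))// addr_ge0//.
      exact: le_trans (normr_ge0 _) farN.
    by rewrite (le_trans _ (near_sum _ tT))// sumr_ge0.
  have h := far_slope _ tT.
  rewrite normrM mulrA ler_pM//; first by rewrite mulr_ge0// ltW.
  by rewrite (le_trans h)// ler_norm.
have [a za] : exists a, `|z a - t| < delta / 2.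
  apply/existsP; apply/contraT; rewrite negb_exists => /forallP far_all.
  have := error_bound _ (fun x => ~~ far x) tT.
  rewrite -splitG Gt subrr sub0r normrN => /(_ _)/(le_trans slope) H.
  have : 2 * (delta * m) <= K1 + K2.
    by apply: H => x ->; rewrite leNgt far_all.
  have : 0 <= K1 + K2.
    rewrite addr_ge0// ?(le_trans (normr_ge0 _) farN)//.
    by rewrite (le_trans _ (near_sum _ tT))// sumr_ge0.
  move: K_small; have := T_gt0=> *;
    move: T_gt0 delta_gt0 delta_le1 delta_leT K_small => *; lra.
(* [a] lies in the window, so [z_sep] applies to it; of the distance [delta], less than [delta / 2]
   is lost between [z a] and [t]. *)
have others x : x != a -> delta / 2 <= `|z x - t|.
  rewrite eq_sym => /z_sep /(_ _)/wrap[].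
    have := lerB_dist (z a) t; move: za tT delta_le1; have := T_gt0=> *;
      move: T_gt0 delta_gt0 delta_le1 delta_leT K_small => *; lra.
  move=> sep; have := ler_distD t (z a) (z x); rewrite (distrC t) ; have := T_gt0=> *;
    move: T_gt0 delta_gt0 delta_le1 delta_leT K_small => *; lra.
have nfar : ~~ far a.
  by apply/negP => fa; have := far_dist_t _ _ fa tT;
    move: T_gt0 delta_gt0 delta_le1 delta_leT K_small => *; lra.
exists a.
  have := error_bound _ (fun x => ~~ far x && (x != a)) tT.
  move=> /(_ _)/wrap[x /andP[-> /others ->]//|].
  have -> : \sum_(x | ~~ far x && (x != a)) (z x - t)^-1 =
      \sum_(x | ~~ far x) (z x - t)^-1 - (z a - t)^-1.
    by rewrite [X in _ = X - _](bigD1 a)//= addrC addrK.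
  rewrite addrA -splitG Gt; set L := t * _ in slope *.
  set v := (z a - t)^-1 => h.
  have -> : `|z a - t|^-1 = `|v| by rewrite /v normfV.
  have := ler_normD (N - v - N - L) v.
  have -> : N - v - N - L + v = - L by ring.
  rewrite normrN; move: K_small; have := T_gt0=> *;
    move: T_gt0 delta_gt0 delta_le1 delta_leT K_small => *; lra.
rewrite (bigID far)/= lerD//.
  rewrite (le_trans _ (far_sqr _ tT))//.
  rewrite big_mkcond [leRHS]big_mkcond/=; apply: ler_sum => x _.
  case: (far x); rewrite ?andbF ?andbT//.
  by case: ifP => // _; rewrite invr_ge0 sqr_ge0.
(* For nonnegative terms the sum of squares is at most the square of the sum, so [near_sum] can be
   used again. *)
have sq (P : pred I) (f : I -> R) : (forall x, 0 <= f x) ->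
    \sum_(x | P x) f x ^+ 2 <= (\sum_(x | P x) f x) ^+ 2.
  move=> f0; rewrite expr2 mulr_suml; apply: ler_sum => x Px.
  by rewrite expr2 ler_wpM2l// (bigD1 x)//= lerDl sumr_ge0.
apply: (@le_trans _ _ (\sum_(x | ~~ far x && (delta / 2 <= `|z x - t|))
    (`|z x - t|^-1) ^+ 2)).
  rewrite big_mkcond [leRHS]big_mkcond/=; apply: ler_sum => x _.
  case: ifPn => [/andP[/others -> ->]/=|_]; last by case: ifP.
  by rewrite exprVn real_normK// num_real.
rewrite (le_trans (sq _ _ _))//.
by rewrite lerXn2r ?nnegrE ?sumr_ge0 ?near_sum// (le_trans _ (near_sum _ tT))// sumr_ge0.
Qed.

End Resolvent.

(** * Comparison of the two norms *)

Section NormRatio.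
Context {R : realType} (M : nat) (f : 'I_M -> R).

Lemma norm_le_linfnorm x : `|f x| <= linfnorm f.
Proof. by rewrite /linfnorm; apply: (le_bigmax _ (fun x => `|f x|)). Qed.

Lemma linfnorm_le c : 0 <= c -> (forall x, `|f x| <= c) -> linfnorm f <= c.
Proof. by move=> c0 fc; rewrite /linfnorm; apply: bigmax_le. Qed.

Lemma norm_ratio_ge c s : 0 < s -> s <= \sum_x f x ^+ 2 -> 0 < c ->
  (forall x, `|f x| <= c) -> Num.sqrt s / c <= l2norm f / linfnorm f.
Proof.
move=> s0 sf c0 fc.
have fE : l2norm f = Num.sqrt (\sum_x f x ^+ 2).
  by congr Num.sqrt; apply: eq_bigr => x _; rewrite real_normK// num_real.
(* A zero sup norm would make the quotient 0 by convention; the lower bound on the squares excludes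
   it. *)
have li0 : 0 < linfnorm f.
  rewrite lt_neqAle (le_trans _ (bigmax_ge_id _ _ _ _))// andbT eq_sym.
  apply/eqP => l0; have : \sum_x f x ^+ 2 = 0.
    apply: big1 => x _; have := norm_le_linfnorm x.
    by rewrite l0 normr_le0 => /eqP ->; rewrite expr0n.
  by move: sf => /[swap] -> /(lt_le_trans s0); rewrite ltxx.
rewrite fE ler_pM ?sqrtr_ge0 ?invr_ge0 ?ler_wsqrtr// ?(ltW c0)//.
by rewrite lef_pV2 ?posrE// linfnorm_le// ltW.
Qed.

(** The squared ratio is at most [1 + s / c ^+ 2], and [sqrt (1 + y) <= 1 + y]. The site [a] need
    not attain the maximum. *)
Lemma norm_ratio_le (a : 'I_M) c s : 0 < c -> c <= `|f a| ->
  \sum_(x | x != a) f x ^+ 2 <= s ->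
  l2norm f / linfnorm f <= 1 + s / c ^+ 2.
Proof.
move=> c0 ca fs.
have ali := norm_le_linfnorm a.
have li0 : 0 < linfnorm f by rewrite (lt_le_trans c0)// (le_trans ca).
have s0 : 0 <= s by rewrite (le_trans _ fs)// sumr_ge0// => x _; rewrite sqr_ge0.
rewrite ler_pdivrMr//.
have h0 : 0 <= (1 + s / c ^+ 2) * linfnorm f.
  by rewrite mulr_ge0 ?(ltW li0)// addr_ge0// divr_ge0// sqr_ge0.
rewrite -(ger0_norm h0) -sqrtr_sqr ler_wsqrtr//.
rewrite (bigD1 a)//= exprMn.
apply: (@le_trans _ _ ((1 + s / c ^+ 2) * linfnorm f ^+ 2)); last first.
  rewrite ler_wpM2r ?sqr_ge0// expr2 ler_peMr//.
    by rewrite addr_ge0// divr_ge0// sqr_ge0.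
  by rewrite lerDl divr_ge0// sqr_ge0.
rewrite mulrDl mul1r lerD ?lerXn2r ?nnegrE ?(ltW li0)//.
apply: (@le_trans _ _ s).
  rewrite (le_trans _ fs)//; apply: ler_sum => x _.
  by rewrite real_normK// num_real.
rewrite mulrAC ler_pdivlMr ?exprn_gt0// ler_wpM2l//.
by rewrite lerXn2r ?nnegrE ?(ltW c0) ?(ltW li0)// (le_trans ca).
Qed.

End NormRatio.

(** * Deterministic analysis of one configuration *)

Section Configuration.
Context {R : realType} (lam : R) (M : nat) (E e : R) (v : 'I_M -> R).
Let k := kappa lam M.
Let D := Delta lam M E.
Let tauM := (e - E) / D.

(** Rescaled potential measured from the reference energy [e], whereas [site_omega] is measured from
    the centre [E]; the two differ by [tauM]. *)
Definition offset (x : 'I_M) : R := (k * v x - e) / D.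
Let z := offset.

(** Label of the gap containing [s], in the form given by [omega_gapP], whether or not an eigenvalue
    lies in that gap. *)
Definition label_at (s : R) : int :=
  (count_below lam M E v s)%:Z - (count_nonpos lam M E v)%:Z + 1.

Hypotheses (M_gt0 : (0 < M)%N) (D_gt0 : 0 < D) (k_neq0 : k != 0).
Hypothesis v_inj : injective v.

Let D_neq0 : D != 0. Proof. by rewrite gt_eqF. Qed.

Lemma site_omegaE x : site_omega lam E v x = z x + tauM.
Proof.
rewrite /site_omega /rescale -/k -/D /z /offset /tauM -mulrDl.
by congr (_ / _); ring.
Qed.

Let offset_sub x u : k * v x - (E + D * u) = D * (z x - (u - tauM)).
Proof. by rewrite /z /offset /tauM; field. Qed.

Lemma eigenvalue_resolvent u :
  (exists2 a : R, eigenvalue (Hmx lam v) a & u = rescale lam M E a) <->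
  (forall x, z x != u - tauM) /\ resolvent z (u - tauM) = M%:R * D.
Proof.
have resE : (forall x, z x != u - tauM) ->
    \sum_x (k * v x - (E + D * u))^-1 = D^-1 * resolvent z (u - tauM).
  move=> zu; rewrite /resolvent mulr_sumr; apply: eq_bigr => x _.
  by rewrite offset_sub invfM.
have neE x : (k * v x != E + D * u) = (z x != u - tauM).
  by rewrite -subr_eq0 offset_sub mulf_eq0 (negbTE D_neq0)/= subr_eq0.
split.
  case=> a Ha uE.
  have aE : a = E + D * u by rewrite uE /rescale -/D mulrC divfK// addrC subrK.
  have [|ne] := eigenvalue_secular _ _ _ _ M_gt0 _ Ha.
    by move=> x x' /(mulfI k_neq0); exact: v_inj.
  have zu x : z x != u - tauM by rewrite -neE -aE.
  rewrite aE => sM; split => //; move: sM; rewrite resE// => <-.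
  by rewrite mulrC mulrA divff// mul1r.
case=> zu rE; exists (E + D * u).
  apply: secular_eigenvalue => // [x|]; first by rewrite neE.
  by rewrite resE// rE mulrC mulfK.
by rewrite /rescale -/D addrC addKr mulrC mulKf.
Qed.

Lemma has_labelP n u : has_label lam E v n u <->
  [/\ forall x, z x != u - tauM, resolvent z (u - tauM) = M%:R * D &
      n = label_at u].
Proof.
rewrite /has_label; split.
  by case=> /eigenvalue_resolvent[? ?] /omega_gapP ?.
by case=> ? ? ?; split; [apply/eigenvalue_resolvent|apply/omega_gapP].
Qed.

Lemma has_label_inj n u u' : has_label lam E v n u -> has_label lam E v n u' ->
  u = u'.
Proof.
wlog uu' : u u' / u <= u'.
  move=> H h h'; case: (leP u u') => [|/ltW] le; first exact: H.
  by apply/esym/H.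
move=> /has_labelP[zu ru ->] /has_labelP[zu' ru' cc].
suff : u - tauM = u' - tauM by apply: addIr.
apply: (resolvent_inj_gap z) => //; last 2 first.
- by rewrite card_ord.
- by rewrite ru.
have : count_below lam M E v u == count_below lam M E v u'.
  by move/addIr/addIr: cc => [->].
rewrite count_below_eq// => /forallP h x.
apply/idP/idP => [/lt_le_trans->//|]; first by rewrite lerD2r.
by have /implyP := h x; rewrite site_omegaE !ltrBrDr.
Qed.

Lemma label_at_neq s u : label_at u <> label_at s ->
  exists x, (u <= site_omega lam E v x < s) || (s <= site_omega lam E v x < u).
Proof.
move=> us; apply/existsP/contraT; rewrite negb_exists => /forallP h.
exfalso; apply: us; rewrite /label_at /count_below; congr (Posz _ - _ + _).
apply: eq_count => x; have := h x; case: ltP => ?; case: ltP => ?//;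
  by rewrite ?orbT.
Qed.

Variables (r T delta Q K1 : R).
Hypothesis e_near : `|e + 1| <= 4^-1.
Hypotheses (r_gt0 : 0 < r) (r_le : r <= 8^-1).
Hypotheses (delta_gt0 : 0 < delta) (delta_le1 : delta <= 1).
Hypotheses (T_ge1 : 1 <= T) (DT_le : D * (2 * T + 2) <= r).
Let far := [pred x | r < `|k * v x - e|].
Hypothesis far_mean : `|D * \sum_(x | far x) (k * v x - e)^-1 - M%:R * D| <= K1.
Hypothesis bulk : M%:R / 2 <= \sum_(x | `|k * v x| <= 2^-1) (1 : R).
Hypothesis near_mass :
  \sum_(x | `|k * v x - e| <= r) (Num.max `|z x| 1)^-1 <= Q.
Hypothesis z_ge : forall x, 2 * delta <= `|z x|.
Hypothesis z_sep : forall x x', x != x' -> `|z x| <= T + 1 ->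
  delta <= `|z x - z x'|.
(** At least [M / 2] bulk sites satisfy [D * |z x| <= 2] and [D * |z x - t| <= 2]; each contributes
    at least [D ^+ 2 / 4] to the slope. *)
Let m := M%:R * D ^+ 2 / 8.
Let K2 := (2 * T + 3) / delta * Q.
(** Each of the at most [M] far sites has [D * |z x - t| >= r / 2]. *)
Let S := 4 * M%:R * D ^+ 2 / r ^+ 2.
Hypothesis K_small : K1 + K2 < delta * m.

Let zD x : k * v x - e = D * z x.
Proof. by rewrite /z /offset; field. Qed.

Let Dn (y : R) : 0 <= D * `|y|.
Proof. exact: mulr_ge0 (ltW D_gt0) (normr_ge0 y). Qed.

Let far_dist x : far x -> 2 * T + 2 <= `|z x|.
Proof.
rewrite /far/= zD normrM (gtr0_norm D_gt0) => h.
by rewrite -(ler_pM2l D_gt0) (le_trans DT_le)// ltW.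
Qed.

Let far_gap x t : far x -> `|t| <= T ->
  r / 2 <= D * `|z x - t| /\ 0 < z x * (z x - t).
Proof.
move=> fx tT; have h := far_dist _ fx.
have h2 : `|z x| / 2 <= `|z x - t|.
  by have := lerB_dist (z x) t => *; lra.
split.
  have : r < D * `|z x| by move: fx; rewrite /far/= zD normrM (gtr0_norm D_gt0).
  move: h2; rewrite -(ler_pM2l D_gt0) => *; lra.
move: h tT T_ge1; rewrite ler_norml => + /andP[? ?] ?.
case: (ger0P (z x)) => z0 h.
  by rewrite mulr_gt0//; lra.
by rewrite nmulr_rgt0//; lra.
Qed.

Let bulk_lower (f : 'I_M -> R) : (forall x, far x -> 0 <= f x) ->
  (forall x, `|k * v x| <= 2^-1 -> D ^+ 2 / 4 <= f x) ->
  m <= \sum_(x | far x) f x.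
Proof.
move=> f0 fb.
(* [e] is within [1/4] of [-1], so a site with [|k * v x| <= 1/2] is at distance at least [1/4 > r]
   from [e]. *)
have bf x : `|k * v x| <= 2^-1 -> far x.
  move: e_near r_le; rewrite /far/= !ler_norml => /andP[? ?] ? /andP[? ?].
  by rewrite (@lt_le_trans _ _ 4^-1)//; [lra|rewrite ler_normr; apply/orP; left; lra].
have D2 : 0 <= D ^+ 2 / 4 by rewrite divr_ge0// sqr_ge0.
apply: (@le_trans _ _ (\sum_(x | `|k * v x| <= 2^-1) D ^+ 2 / 4)).
  rewrite -[X in \sum_(x | _) X]mulr1 -mulr_sumr.
  have -> : m = D ^+ 2 / 4 * (M%:R / 2) by rewrite /m; field.
  exact: ler_wpM2l.
rewrite big_mkcond [leRHS]big_mkcond/=; apply: ler_sum => x _.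
case: ifPn => [h|_]; first by have := bf _ h; rewrite /far/= => ->; exact: fb.
by case: ifP => // /f0.
Qed.

Let bulk_bounds x t : `|k * v x| <= 2^-1 -> `|t| <= T ->
  D * `|z x| <= 2 /\ D * `|z x - t| <= 2.
Proof.
move=> h tT; have Dt : D * `|t| <= 8^-1.
  have := ler_wpM2l (ltW D_gt0) tT.
  move: DT_le r_le D_gt0 => *.
  have : 0 <= D * T by rewrite mulr_ge0// ltW//; move: T_ge1 => *; lra.
  lra.
have h1 : D * `|z x| <= 7 / 4.
  rewrite -[X in X * _](gtr0_norm D_gt0) -normrM -zD.
  rewrite (le_trans (ler_normB _ _))//.
  move: e_near h; rewrite ler_norml => /andP[? ?] ?.
  have : `|e| <= 5 / 4 by rewrite ler_norml; apply/andP; split; lra.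
  move=> *; lra.
split; first by lra.
have := ler_wpM2l (ltW D_gt0) (ler_normB (z x) t); rewrite mulrDr => *; lra.
Qed.

Let far_slope t : `|t| <= T ->
  m <= \sum_(x | far x) (z x * (z x - t))^-1.
Proof.
move=> tT; apply: bulk_lower => [x fx|x bx].
  by rewrite invr_ge0 ltW//; have [] := far_gap _ _ fx tT.
have fx : far x.
  move: e_near r_le bx; rewrite /far/= !ler_norml => /andP[? ?] ? /andP[? ?].
  by rewrite (@lt_le_trans _ _ 4^-1)//; [lra|rewrite ler_normr; apply/orP; left; lra].
have [_ p0] := far_gap _ _ fx tT; have [b1 b2] := bulk_bounds _ _ bx tT.
rewrite -[X in _ <= X]mul1r ler_pdivlMr// -(gtr0_norm p0) normrM.
have -> : D ^+ 2 / 4 * (`|z x| * `|z x - t|) =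
  (D * `|z x|) * (D * `|z x - t|) / 4 by field.
have := ler_pM (Dn _) (Dn _) b1 b2.
by move=> *; lra.
Qed.

Let far_sqr_ge t : `|t| <= T -> m <= \sum_(x | far x) (z x - t) ^- 2.
Proof.
move=> tT; apply: bulk_lower => [x fx|x bx].
  by rewrite invr_ge0 sqr_ge0.
have fx : far x.
  move: e_near r_le bx; rewrite /far/= !ler_norml => /andP[? ?] ? /andP[? ?].
  by rewrite (@lt_le_trans _ _ 4^-1)//; [lra|rewrite ler_normr; apply/orP; left; lra].
have [_ p0] := far_gap _ _ fx tT; have [b1 b2] := bulk_bounds _ _ bx tT.
have zt0 : 0 < (z x - t) ^+ 2.
  rewrite exprn_even_gt0//=; apply/eqP => h; move: p0; rewrite h mulr0 ltxx.
  by [].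
rewrite -[X in _ <= X]mul1r ler_pdivlMr// -[(z x - t) ^+ 2]real_normK ?num_real//.
have -> : D ^+ 2 / 4 * `|z x - t| ^+ 2 =
  (D * `|z x - t|) * (D * `|z x - t|) / 4 by field.
have := ler_pM (Dn _) (Dn _) b2 b2.
by move=> *; lra.
Qed.

Let far_sqr t : `|t| <= T -> \sum_(x | far x) (z x - t) ^- 2 <= S.
Proof.
move=> tT; apply: (@le_trans _ _ (\sum_(x < M) 4 * D ^+ 2 / r ^+ 2)).
  rewrite [leLHS]big_mkcond/=; apply: ler_sum => x _.
  case: ifPn => [fx|_]; last first.
    by rewrite divr_ge0 ?sqr_ge0// mulr_ge0// sqr_ge0.
  have [h _] := far_gap _ _ fx tT.
  have zt0 : 0 < (z x - t) ^+ 2.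
    rewrite exprn_even_gt0//= -normr_eq0 gt_eqF// -(pmulr_rgt0 _ D_gt0).
    by rewrite (lt_le_trans _ h)// divr_gt0.
  rewrite -[X in X <= _]mul1r ler_pdivrMr// mulrAC ler_pdivlMr ?exprn_gt0//.
  rewrite mul1r -[(z x - t) ^+ 2]real_normK ?num_real//.
  have := ler_pM _ _ h h; rewrite !divr_ge0 ?(ltW r_gt0)// => /(_ isT isT).
  have -> : D * `|z x - t| * (D * `|z x - t|) = D ^+ 2 * `|z x - t| ^+ 2 by ring.
  by move=> *; lra.
by rewrite sumr_const card_ord -[leLHS]mulr_natl /S -!mulrA [M%:R * _]mulrCA.
Qed.

(** [near_mass] does not depend on [t], so one random estimate serves the whole window:
    [(2 * T + 3) / delta] bounds the ratio of [max (|z x|, 1)] to [|z x - t|] once the latter is at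
    least [delta / 2]. *)
Let near_sum t : `|t| <= T ->
  \sum_(x | ~~ far x && (delta / 2 <= `|z x - t|)) `|z x - t|^-1 <= K2.
Proof.
move=> tT; have c0 : 0 <= (2 * T + 3) / delta.
  by rewrite divr_ge0 ?(ltW delta_gt0)//; move: T_ge1 => *; lra.
rewrite /K2 (le_trans _ (ler_wpM2l c0 near_mass))// mulr_sumr.
rewrite [leLHS]big_mkcond [leRHS]big_mkcond/=; apply: ler_sum => x _.
rewrite -leNgt; case: (_ <= r) => //=; last first.
case: ifPn => [zt|_]; last first.
  by rewrite mulr_ge0// invr_ge0 le_max ler01 orbT.
have mx : 0 < Num.max `|z x| 1 by rewrite lt_max ltr01 orbT.
have zt0 : 0 < `|z x - t| by rewrite (lt_le_trans _ zt)// divr_gt0.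
rewrite -[X in X <= _]mul1r ler_pdivrMr//.
have -> : (2 * T + 3) / delta / Num.max `|z x| 1 * `|z x - t| =
    (2 * T + 3) * `|z x - t| / (delta * Num.max `|z x| 1).
  by field; rewrite !gt_eqF.
rewrite ler_pdivlMr ?mulr_gt0// mul1r.
have dz : delta <= 2 * `|z x - t| by lra.
have d0 := delta_gt0; have d1 := delta_le1; have T1 := T_ge1.
rewrite maxr_pMr ?(ltW d0)// ge_max; apply/andP; split; last first.
  have : 0 <= T * `|z x - t| by rewrite mulr_ge0// ?(ltW zt0)//; lra.
  by move=> *; rewrite mulr1; lra.
have : `|z x| <= `|z x - t| + T.
  by have := ler_normD (z x - t) t; rewrite subrK => *; lra.
move=> h; rewrite (le_trans (ler_wpM2l (ltW d0) h))//.
have T0 : 0 <= T by lra.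
have a1 := ler_wpM2l T0 dz.
have a2 : delta * `|z x - t| <= `|z x - t| by rewrite ler_piMl// ltW.
lra.
Qed.

Let delta_leT : delta <= T.
Proof. exact: le_trans delta_le1 T_ge1. Qed.

Let far_meanz : `|\sum_(x | far x) (z x)^-1 - M%:R * D| <= K1.
Proof.
suff -> : \sum_(x | far x) (z x)^-1 = D * \sum_(x | far x) (k * v x - e)^-1.
  exact: far_mean.
rewrite mulr_sumr; apply: eq_bigr => x _.
by rewrite zD [(D * z x)^-1]invfM mulVKf.
Qed.

Let localP := @resolvent_localized R _ z far (M%:R * D) K1 K2 m T delta S
  delta_gt0 delta_le1 delta_leT far_meanz far_dist far_slope near_sum far_sqr
  K_small z_sep.

Let rootP := @resolvent_root R _ z far (M%:R * D) K1 K2 m T delta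
  delta_gt0 delta_le1 delta_leT far_meanz far_dist far_slope near_sum K_small z_ge.

Let off_delta t x : `|t| <= delta -> delta <= `|z x - t|.
Proof.
move=> td; have := lerB_dist (z x) t; have := z_ge x.
by move: delta_gt0 => *; lra.
Qed.

(** The root and [tauM] share a gap: the root is within [delta] of [tauM], and every site is at
    least [2 * delta] away from it. *)
Lemma has_label_root : exists2 u,
  has_label lam E v (label_at tauM) u & `|u - tauM| <= delta.
Proof.
have [t td rt] := rootP; exists (t + tauM); last by rewrite addrK.
apply/has_labelP; rewrite addrK; split=> // [x|].
  by rewrite -subr_eq0 -normr_eq0 gt_eqF// (lt_le_trans delta_gt0)// off_delta.
apply/eqP; apply: contraT => /eqP/nesym/label_at_neq[x].
rewrite !site_omegaE.
have := off_delta t x td; have := z_ge x; move: td delta_gt0.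
rewrite ler_norml => /andP[? ?] ?.
rewrite !ler_normr => /orP[?|?] /orP[?|?] /orP[/andP[? ?]|/andP[? ?]]; lra.
Qed.

(** Delocalization: the far sites give squared mass at least [m], and no site is closer than [delta]
    to the root, so no entry exceeds [1 / delta]. *)
Lemma eig_label_at : let n := label_at tauM in
  [/\ labelled lam E v n, `|eig lam E v n - tauM| <= delta &
      Num.sqrt m * delta <= norm_ratio lam E v n].
Proof.
move=> n; have [u lu uu] := has_label_root.
have lu' : labelled lam E v n by exists u.
have -> : eig lam E v n = u.
  rewrite /eig; case: xgetP => [a _ /has_label_inj/(_ lu)//|].
  by move=> /(_ u).
have eigE : eig lam E v n = u.
  rewrite /eig; case: xgetP => [a _ /has_label_inj/(_ lu)//|].
  by move=> /(_ u).
have psiE x : psi lam E v n x = (z x - (u - tauM))^-1.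
  by rewrite /psi eigE site_omegaE div1r; congr (_^-1); ring.
have dT : `|u - tauM| <= T by rewrite (le_trans uu).
have m0 : 0 < m.
  by rewrite /m divr_gt0// mulr_gt0 ?ltr0n// exprn_gt0.
split=> //; rewrite -[X in _ * X]invrK; apply: norm_ratio_ge => //.
- rewrite (le_trans (far_sqr_ge _ dT))// [leLHS]big_mkcond/=.
  apply: ler_sum => x _; rewrite psiE exprVn.
  by case: ifP => // _; rewrite invr_ge0 sqr_ge0.
- by rewrite invr_gt0.
- move=> x; rewrite psiE normfV lef_pV2 ?posrE ?off_delta//.
  by rewrite (lt_le_trans delta_gt0)// off_delta.
Qed.

Lemma eig_label_other n : n <> label_at tauM -> labelled lam E v n ->
  `|eig lam E v n| + `|tauM| <= T ->
  norm_ratio lam E v n <= 1 + (S + K2 ^+ 2) / (delta * m) ^+ 2.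
Proof.
move=> nn [u0 lu0]; set u := eig _ _ _ _ => uT.
have /has_labelP[zu ru nE] : has_label lam E v n u.
  by rewrite /u /eig; apply: xgetPex; exists u0.
have tT : `|u - tauM| <= T by rewrite (le_trans (ler_normB _ _)).
(* A change of label forces a site between the eigenvalue and [tauM], and that site is already
   [2 * delta] away from [tauM]. *)
have td : 2 * delta <= `|u - tauM|.
  have /label_at_neq[x] : label_at u <> label_at tauM by rewrite -nE.
  rewrite site_omegaE; have := z_ge x; rewrite !ler_normr.
  move: delta_gt0 => ? /orP[?|?] /orP[/andP[? ?]|/andP[? ?]];
    apply/orP; ((left; lra) || (right; lra)).
have [a za sa] := localP _ tT td zu ru.
have psiE x : psi lam E v n x = (z x - (u - tauM))^-1.
  by rewrite /psi -/u site_omegaE div1r; congr (_^-1); ring.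
have m0 : 0 < m.
  by rewrite /m divr_gt0// mulr_gt0 ?ltr0n// exprn_gt0.
apply: (@norm_ratio_le _ _ _ a); first by rewrite mulr_gt0.
  by rewrite psiE normfV.
rewrite (le_trans _ sa)//; apply: ler_sum => x _.
by rewrite psiE exprVn.
Qed.

End Configuration.

(** * Independent Gaussian variables *)

Section Integrals.
Context d {T : measurableType d} {R : realType}.
Local Open Scope ereal_scope.

Lemma markov_ge0 (m : {measure set T -> \bar R}) (f : T -> R) (a c : R) :
  (0 < c)%R -> measurable_fun setT f -> (forall w, 0 <= f w)%R ->
  \int[m]_w (f w)%:E <= a%:E -> m [set w | (c <= f w)%R] <= (a / c)%:E.
Proof.
move=> c0 mf f0 fa.
have := @le_integral_abse _ _ _ m setT measurableT (EFin \o f) c.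
move=> /(_ _ c0)/wrap[]; first exact/measurable_EFinP.
rewrite setTI => h; rewrite EFinM lee_pdivlMr// muleC.
have fE : \int[m]_x `|(EFin \o f) x| = \int[m]_w (f w)%:E.
  by apply: eq_integral => w _ /=; rewrite ger0_norm.
rewrite fE in h; apply: (le_trans _ (le_trans h fa)).
rewrite (_ : [set w | (c <= f w)%R] = [set x | c%:E <= `|(EFin \o f) x|])//.
by apply/seteqP; split => w /=; rewrite lee_fin ger0_norm.
Qed.

Lemma bounded_integrable (m : {finite_measure set T -> \bar R}) (f : T -> R)
    (b : R) : measurable_fun setT f -> (forall w, `|f w| <= b)%R ->
  m.-integrable setT (EFin \o f).
Proof.
move=> mf fb; apply: measurable_bounded_integrable => //.
  by rewrite ltey_eq fin_num_measure.
by exists b; split; [exact: num_real|move=> y yb w _; exact: le_trans (fb w) (ltW yb)].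
Qed.

End Integrals.

Section Independence.
Context d {T : measurableType d} {R : realType} (P : probability T R)
  (I : finType) (X : I -> {RV P >-> R}).
Hypothesis hX : iid_std_gaussian X.
Local Open Scope ereal_scope.
Local Notation mu := (@normal_prob R 0%R 1%R).
Local Notation Rm := (measurableTypeR R).

(* The Gaussian measure of the library lives on [measurableTypeR R], which is
   [R] with the same measurable sets but another display. *)
Let X' (i : I) : T -> Rm := X i.

Let mX' i : measurable_fun setT (X' i).
Proof. have := @measurable_funP _ _ _ _ setT (X i); exact. Qed.

HB.instance Definition _ i := isMeasurableFun.Build _ _ _ _ (X' i) (mX' i).

Lemma ge0_integral_law i (f : Rm -> R) : measurable_fun setT f ->
  (forall v, 0 <= f v)%R ->
  \int[P]_w (f (X i w))%:E = \int[mu]_v (f v)%:E.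
Proof.
move=> mf f0; have mf' : measurable_fun setT (EFin \o f) by exact/measurable_EFinP.
rewrite -(@ge0_integral_distribution _ _ _ _ _ P (X' i) (EFin \o f))//.
by apply: eq_measure_integral => A mA _; exact: hX.2.
Qed.

Section Pair.
Variables (i j : I) (ij : i != j).

Let XY (w : T) : (Rm * Rm)%type := (X' i w, X' j w).

Let mXY : measurable_fun setT XY.
Proof. by apply: measurable_fun_pair; exact: mX'. Qed.

HB.instance Definition _ := isMeasurableFun.Build _ _ _ _ XY mXY.

(** Product measures are determined on rectangles; indices other than [i] and [j] receive [setT] in
    the product rule. *)
Lemma pair_law (A : set (Rm * Rm)) : measurable A ->
  P (XY @^-1` A) = (mu \x mu) A.
Proof.
move=> mA; apply/esym.
rewrite (_ : P _ = distribution P XY A)//.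
apply: (@product_measure_unique _ _ _ _ _ mu mu (distribution P XY)) => //.
move=> B C mB mC.
pose D k := if k == i then B else if k == j then C else setT.
have mD k : measurable (D k) by rewrite /D; case: ifP => // _; case: ifP.
have := hX.1 D mD; rewrite (bigD1 i)//= (bigD1 j)/=; last by rewrite eq_sym.
rewrite big1 ?mule1; last first.
  by move=> k /andP[/negbTE ki /negbTE kj]; rewrite /D ki kj preimage_setT probability_setT.
rewrite {2 3}/D eqxx eq_sym (negbTE ij) eqxx.
rewrite [P (X i @^-1` B)]hX.2// [P (X j @^-1` C)]hX.2// => <-.
rewrite /distribution /pushforward; congr (P _); apply/seteqP; split => w /=.
  move=> [Bw Cw] k _ /=; rewrite /D; case: eqP => [->//|_].
  by case: eqP => [->|].
move=> h; split.
  by have := h i Logic.I; rewrite /D /= eqxx.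
by have := h j Logic.I; rewrite /D /= eqxx eq_sym (negbTE ij).
Qed.

(** Fubini: the section of [A] over [a] has mass at most [b] for [a] in [S] and is empty
    otherwise. *)
Lemma pair_prob_le (A : set (Rm * Rm)) (S : set Rm) (b : R) : measurable A ->
  measurable S -> (0 <= b)%R -> (forall a v, A (a, v) -> S a) ->
  (forall a, S a -> mu (xsection A a) <= b%:E) ->
  P [set w | A (X i w, X j w)] <= b%:E * mu S.
Proof.
move=> mA mS b0 AS Ab; have := pair_law _ mA; rewrite /preimage/= => ->.
rewrite /product_measure1/= -integral_cst// [leRHS]integral_mkcond.
apply: ge0_le_integral => //.
- exact: measurable_fun_xsection.
- by apply/measurable_restrict => //=; rewrite ?setTI.
move=> a _; rewrite patchE; case: ifPn => [/set_mem/Ab//|/negP aS].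
rewrite (_ : xsection A a = set0) ?measure0//.
apply/seteqP; split => v //=; rewrite /xsection/= inE => /AS Sa.
by apply: aS; rewrite inE.
Qed.

Lemma pair_expectation (g : Rm -> R) (b : R) : measurable_fun setT g ->
  (forall v, `|g v| <= b)%R -> \int[mu]_v (g v)%:E = 0 ->
  \int[P]_w (g (X i w) * g (X j w))%:E = 0.
Proof.
move=> mg gb g0; pose G (z : (Rm * Rm)%type) := (g z.1 * g z.2)%:E.
have mG : measurable_fun setT G.
  apply/measurable_EFinP/measurable_funM.
    by apply: measurableT_comp => //; exact: measurable_fst.
  by apply: measurableT_comp => //; exact: measurable_snd.
have Gb w : (`|g (X i w) * g (X j w)| <= b * b)%R by rewrite normrM ler_pM.
have mgX k : measurable_fun setT (fun w => g (X k w)).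
  exact: (@measurableT_comp _ _ _ _ _ _ g _ (X' _)).
transitivity (\int[distribution P XY]_z G z).
  rewrite integral_distribution//.
  apply: (@bounded_integrable _ _ _ _ _ (b * b)) => //=.
  exact: (measurable_funM (mgX i) (mgX j)).
transitivity (\int[mu \x mu]_z G z).
  by apply: eq_measure_integral => A mA _; exact: pair_law.
rewrite -integral12_prod_meas1; last first.
  apply/integrableP; split => //.
  have nG : measurable_fun setT (abse \o G) by exact: measurableT_comp.
  apply: (@le_lt_trans _ _ (\int[mu \x mu]_z (b * b)%:E)).
    apply: ge0_le_integral => //= z _.
    by rewrite lee_fin normrM ler_pM.
  have mass1 : (mu \x mu) [set: (Rm * Rm)%type] = 1.
    have m1 : mu [set: Rm] = 1 by exact: probability_setT.
    rewrite -setXTT; apply: etrans (product_measure1E _ _ _ _) _ => //.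
    by rewrite [X in X * _]m1 [X in _ * X]m1 mule1.
  by rewrite integral_cst// [X in (_ * X)%E]mass1 mule1 ltry.
rewrite /fubini_F/= /G/= integral0_eq// => a _.
under eq_integral do rewrite EFinM.
rewrite integralZl//; first by rewrite g0 mule0.
exact: (@bounded_integrable _ _ _ _ _ b).
Qed.

End Pair.

Lemma markov_sum (f : Rm -> R) (a c : R) : measurable_fun setT f ->
  (forall v, 0 <= f v)%R -> \int[mu]_v (f v)%:E <= a%:E -> (0 < c)%R ->
  P [set w | (c <= \sum_i f (X i w))%R] <= (#|I|%:R * a / c)%:E.
Proof.
move=> mf f0 fa c0.
have mfX i : measurable_fun setT (fun w => f (X i w)).
  exact: (@measurableT_comp _ _ _ _ _ _ f _ (X' _)).
apply: markov_ge0 => //; first exact: measurable_sum.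
  by move=> w; exact: sumr_ge0.
under eq_integral do rewrite -sumEFin.
rewrite ge0_integral_sum//; last 2 first.
- by move=> i; exact/measurable_EFinP.
- by move=> i w _; rewrite lee_fin.
rewrite (eq_bigr (fun=> \int[mu]_v (f v)%:E)); last first.
  by move=> i _; exact: ge0_integral_law.
apply: (@le_trans _ _ (\sum_(i : I) a%:E)); first exact: lee_sum.
rewrite sumEFin sumr_const lee_fin; by rewrite mulr_natl.
Qed.

(** Second moment: [pair_expectation] removes the off-diagonal terms, and each diagonal one is at
    most [b ^+ 2]. *)
Lemma chebyshev_sum (g : Rm -> R) (b c : R) : measurable_fun setT g ->
  (forall v, `|g v| <= b)%R -> \int[mu]_v (g v)%:E = 0 -> (0 < c)%R ->
  P [set w | (c <= `|\sum_i g (X i w)|)%R] <= (#|I|%:R * b ^+ 2 / c ^+ 2)%:E.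
Proof.
move=> mg gb g0 c0.
have mgX i : measurable_fun setT (fun w => g (X i w)).
  exact: (@measurableT_comp _ _ _ _ _ _ g _ (X' _)).
rewrite (_ : [set _ | _] =
    [set w | (c ^+ 2 <= (\sum_i g (X i w)) ^+ 2)%R]); last first.
  apply/seteqP; split => w /=; rewrite -[((\sum_i _) ^+ 2)%R]real_normK ?num_real//;
    by rewrite ler_pXn2r ?nnegrE// ltW.
apply: markov_ge0; first by rewrite exprn_gt0.
- by apply: measurable_funX; exact: measurable_sum.
- by move=> w; rewrite sqr_ge0.
have gij i j w : (`|g (X i w) * g (X j w)| <= b * b)%R by rewrite normrM ler_pM.
have igg i j : P.-integrable setT (EFin \o (fun w => g (X i w) * g (X j w)))%R.
  apply: (@bounded_integrable _ _ _ _ _ (b * b)) => //=.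
  exact: measurable_funM.
under eq_integral.
  move=> w _; rewrite expr2 mulr_suml.
  under eq_bigr do rewrite mulr_sumr.
  rewrite -sumEFin; under eq_bigr do rewrite -sumEFin.
  over.
rewrite integral_sum//; last first.
  by move=> i; apply: integrable_sum => // j _; exact: igg.
rewrite (eq_bigr (fun i => \int[P]_w (g (X i w) * g (X i w))%:E)); last first.
  move=> i _; rewrite integral_sum//; last by move=> j; exact: igg.
  rewrite (bigD1 i)//= big1 ?adde0// => j ji.
  by rewrite (pair_expectation _ _ _ g b)// eq_sym.
apply: (@le_trans _ _ (\sum_(i : I) (b ^+ 2)%:E)); last first.
  by rewrite sumEFin sumr_const lee_fin mulr_natl.
apply: lee_sum => i _; rewrite expr2.
apply: (@le_trans _ _ (\int[P]_w (cst (b * b)%:E) w)); last first.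
  by rewrite integral_cst// [X in (_ * X)%E]probability_setT mule1.
apply: le_integral => //; first exact: igg.
  exact: (finite_measure_integrable_cst P (b * b)).
by move=> w _ /=; rewrite lee_fin (le_trans (ler_norm _)).
Qed.

(** Union bound through Markov for the number of ordered bad pairs, which is at least 1 as soon as
    one pair is bad. *)
Lemma pair_union_le (A : set (Rm * Rm)) (a : R) : measurable A ->
  (forall i j, i != j -> P [set w | A (X i w, X j w)] <= a%:E) -> (0 <= a)%R ->
  exists2 B, measurable B /\ P B <= (#|I|%:R ^+ 2 * a)%:E &
    forall w, ~ B w -> forall i j, i != j -> ~ A (X i w, X j w).
Proof.
move=> mA Aa a0.
pose f w : R := (\sum_(i : I) \sum_(j : I)
   (if i != j then \1_[set w | A (X i w, X j w)] w else 0))%R.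
have mAX i j : measurable [set w | A (X i w, X j w)].
  have mp : measurable_fun setT (fun w => (X' i w, X' j w)).
    by apply: (@measurable_fun_pair _ _ _ _ _ _ (X' i) (X' j)); exact: mX'.
  by rewrite -[X in measurable X]setTI; exact: mp.
have mij i j : measurable_fun setT
    (fun w => if i != j then \1_[set w | A (X i w, X j w)] w else 0%R : R).
  by case: (i != j) => //; apply: measurable_indic.
have mf : measurable_fun setT f.
  by apply: measurable_sum => i; apply: measurable_sum => j.
have fij0 i j w : (0 <= (if i != j then \1_[set w | A (X i w, X j w)] w else 0%R : R))%R.
  by case: ifP.
exists [set w | (1 <= f w)%R]; first split.
- rewrite -[X in measurable X]setTI.
  rewrite (_ : [set w | _] = f @^-1` `[1%R, +oo[%classic); last first.
    by apply/seteqP; split => w /=; rewrite in_itv/= andbT.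
  exact: mf.
- have -> : (#|I|%:R ^+ 2 * a = #|I|%:R ^+ 2 * a / 1)%R by rewrite divr1.
  apply: markov_ge0 => //.
    by move=> w; apply: sumr_ge0 => i _; apply: sumr_ge0.
  under eq_integral.
    move=> w _; rewrite -sumEFin; under eq_bigr do rewrite -sumEFin.
    over.
  rewrite ge0_integral_sum//; last 2 first.
  + by move=> i; apply: emeasurable_sum => j; exact/measurable_EFinP.
  + by move=> i w _; apply: sume_ge0 => j _; rewrite lee_fin.
  apply: (@le_trans _ _ (\sum_(i : I) \sum_(j : I) a%:E)).
    apply: lee_sum => i _; rewrite ge0_integral_sum//; last 2 first.
    + by move=> j; exact/measurable_EFinP.
    + by move=> j w _; rewrite lee_fin.
    apply: lee_sum => j _; case: (boolP (i != j)) => [ij|_]; last by rewrite integral0 lee_fin.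
    by rewrite integral_indic// setIT; exact: Aa.
  under eq_bigr do rewrite sumEFin sumr_const.
  rewrite sumEFin sumr_const lee_fin.
  by rewrite expr2 -mulrA !mulr_natl.
move=> w /= fw i j ij Aij; apply: fw; rewrite /f (bigD1 i)//= (bigD1 j)//= ij.
have -> : \1_[set w | A (X i w, X j w)] w = 1%R :> R.
  by rewrite indicE mem_set.
rewrite -addrA lerDl addr_ge0//; first by apply: sumr_ge0 => k _; exact: fij0.
by apply: sumr_ge0 => k _; apply: sumr_ge0 => l _; exact: fij0.
Qed.

End Independence.

(** * The Gaussian density *)

Section GaussianDensity.
Context {R : realType}.
Local Notation Rm := (measurableTypeR R).
Local Notation leb := (@lebesgue_measure R).
Local Notation gauss := (@normal_prob R 0 1).

Lemma rhoE : @rho R = normal_pdf 0 1.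
Proof. by apply/funext => v; rewrite rho_normal_pdf. Qed.

Lemma rho_ge0 (v : R) : 0 <= rho v.
Proof. by rewrite rhoE normal_pdf_ge0. Qed.

Lemma rho_gt0 (v : R) : 0 < rho v.
Proof. by rewrite divr_gt0 ?expR_gt0// sqrtr_gt0 mulr_gt0// pi_gt0. Qed.

Lemma rho_le_expR (v : R) : rho v <= expR (- v ^+ 2 / 2).
Proof.
rewrite ler_pdivrMr; last by rewrite sqrtr_gt0 mulr_gt0// pi_gt0.
rewrite ler_peMr ?expR_ge0//; rewrite -[leLHS]sqrtr1 ler_wsqrtr//.
by have := pi_ge2 R; lra.
Qed.

Lemma measurable_rho : measurable_fun [set: Rm] (@rho R).
Proof. by rewrite rhoE; exact: measurable_normal_pdf. Qed.

Lemma continuous_rho : continuous (@rho R).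
Proof. by rewrite rhoE; exact/continuous_normal_pdf/oner_neq0. Qed.

Lemma integrable_rho : leb.-integrable [set: Rm] (EFin \o @rho R).
Proof. by rewrite rhoE; exact: integrable_normal_pdf. Qed.

Lemma is_derive_rho (v : R) : is_derive v 1 (@rho R) (- v * rho v).
Proof.
rewrite /rho; set C := (Num.sqrt _)^-1.
have h : is_derive v 1 (fun v : R => - v ^+ 2 / 2) (- v).
  by apply: is_derive_eq; rewrite /GRing.scale/=; field.
have H := @is_derive1_comp R expR (fun v : R => - v ^+ 2 / 2) v _ _
  (is_derive_expR _) h.
rewrite (_ : (fun _ => _) = C \*: (expR \o (fun v : R => - v ^+ 2 / 2))).
  by apply: is_derive_eq; rewrite /GRing.scale/=; ring.
by apply/funext => x; rewrite /= /GRing.scale/= mulrC.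
Qed.

Lemma rho_lipschitz (a b L : R) : (forall v, v \in `[a, b] -> `|v * rho v| <= L) ->
  forall u v, u \in `[a, b] -> v \in `[a, b] -> `|rho u - rho v| <= L * `|u - v|.
Proof.
move=> Lv u v; wlog uv : u v / v <= u.
  move=> H uab vab; case: (leP v u) => [|/ltW] h; first exact: H.
  by rewrite distrC [`|u - v|]distrC; exact: H.
rewrite !in_itv/= => /andP[au ub] /andP[av vb].
have [||w] := @MVT_segment R rho (fun v => - v * rho v) v u uv.
- by move=> x _; exact: is_derive_rho.
- exact/continuous_subspaceT/continuous_rho.
rewrite in_itv/= => /andP[vw wu] ->; rewrite normrM ler_wpM2r//.
by rewrite mulNr normrN Lv// in_itv/= (le_trans av)// (le_trans wu).
Qed.

Lemma normal_prob_le (S : set Rm) (a b s : R) : measurable S ->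
  S `<=` `[a, b]%classic -> a <= b -> 0 <= s -> (forall v, S v -> rho v <= s) ->
  (gauss S <= (s * (b - a))%:E)%E.
Proof.
move=> mS Sab ab s0 Ss; rewrite /normal_prob -rhoE.
apply: (@le_trans _ _ (\int[leb]_(x in S) (cst s%:E) x)%E).
  apply: ge0_le_integral => //.
  - by move=> x _; rewrite lee_fin rho_ge0.
  - by apply/measurable_EFinP/measurable_funTS; exact: measurable_rho.
rewrite integral_cst// EFinM lee_wpmul2l ?lee_fin//.
have -> : ((b - a)%:E = leb `[a, b]%classic)%E.
  rewrite lebesgue_measure_itv/= lte_fin; move: ab; rewrite le_eqVlt.
  by move=> /predU1P[->|->]; [rewrite ltxx subrr|rewrite EFinB].
by apply: le_measure => //; rewrite inE.
Qed.

(** For signed integrands the change of measure goes through the Radon-Nikodym derivative of the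
    Gaussian, which equals [rho] almost everywhere. *)
Lemma integral_normal (f : Rm -> R) (b : R) : measurable_fun setT f ->
  (forall v, `|f v| <= b) ->
  (\int[gauss]_v (f v)%:E = \int[leb]_v (f v * rho v)%:E)%E.
Proof.
move=> mf fb; have dom := @normal_prob_dominates R 0 1.
have fint : gauss.-integrable setT (EFin \o f) by exact: (@bounded_integrable _ _ _ _ _ b).
rewrite -(Radon_Nikodym_change_of_variables dom measurableT fint).
have domc : charge_of_finite_measure gauss `<< leb := dom.
have mRN := measurable_int _ (Radon_Nikodym_integrable domc).
apply: ae_eq_integral => //.
- apply: emeasurable_funM => //; exact/measurable_EFinP.
- by apply/measurable_EFinP/measurable_funM => //; exact: measurable_rho.
have : ae_eq leb setT (Radon_Nikodym (charge_of_finite_measure gauss) leb) (EFin \o rho).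
  apply: integral_ae_eq => //.
  - exact: Radon_Nikodym_integrable.
  - by apply/measurable_EFinP; exact: measurable_rho.
  - by move=> E _ mE; rewrite -Radon_Nikodym_integral// rhoE.
apply: filterS => v H _; rewrite /= H//.
Qed.

End GaussianDensity.

(** * The principal value *)

Section PrincipalValue.
Context {R : realType}.
Local Notation Rm := (measurableTypeR R).
Local Notation leb := (@lebesgue_measure R).
Local Notation gauss := (@normal_prob R 0 1).

Lemma measurable_invr : measurable_fun [set: Rm] (fun v : R => v^-1).
Proof.
have -> : (fun v : R => v^-1) = (fun v => if v == 0 then 0 else v^-1).
  by apply/funext => v; case: eqP => // ->; rewrite invr0.
apply: measurable_fun_if => //.
- by apply: measurable_fun_eqr; [exact: measurable_id|exact: measurable_cst].
- rewrite setTI (_ : _ @^-1` _ = [set v : R | v != 0]); last first.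
    by apply/seteqP; split => v /=; case: eqP.
  apply: open_continuous_measurable_fun; first exact: open_neq.
  by move=> v; rewrite inE/= => v0; exact: inv_continuous.
Qed.

Section Kernel.
Variables (k e r Lp : R).
Hypotheses (k_gt0 : 0 < k) (r_gt0 : 0 < r).
Let c := e / k.
Let rr := r / k.
Hypothesis rho_lip : forall u v : R, u \in `[c - rr, c + rr] ->
  v \in `[c - rr, c + rr] -> `|rho u - rho v| <= Lp * `|u - v|.

Let h (v : R) : R := rho v / (k * v - e).

Let kE v : k * v - e = k * (v - c).
Proof. by rewrite /c; field; rewrite gt_eqF. Qed.

Let mh : measurable_fun [set: Rm] h.
Proof.
apply: measurable_funM; first exact: measurable_rho.
apply: measurableT_comp; first exact: measurable_invr.
by apply: measurable_funB => //; apply: measurable_funM.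
Qed.

Let outer (eps : R) : set Rm := [set v | eps < `|v - c|].

Let m_outer eps : measurable (outer eps).
Proof.
rewrite -[X in measurable X]setTI.
rewrite (_ : outer eps = (fun v : R => `|v - c|) @^-1` `]eps, +oo[%classic).
  have : measurable_fun [set: Rm] (fun v : R => `|v - c|).
    by apply: measurableT_comp => //; exact: measurable_funB.
  by move=> H; exact: H.
by apply/seteqP; split => v /=; rewrite in_itv/= andbT.
Qed.

Let integrable_outer eps : 0 < eps -> leb.-integrable (outer eps) (EFin \o h).
Proof.
move=> e0.
have ig : leb.-integrable (outer eps) (EFin \o (fun v => (k * eps)^-1 * rho v)).
  apply: (@integrableS _ _ _ _ setT) => //.
  by have := @integrableZl _ _ _ leb setT measurableT (k * eps)^-1
    (EFin \o rho) integrable_rho.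
apply: (le_integrable (m_outer eps) _ _ ig).
- by apply/measurable_EFinP; exact: measurable_funS mh.
- move=> v; rewrite /outer/= => ev; rewrite lee_fin /h (le_trans _ (ler_norm _))// normrM.
  rewrite (ger0_norm (rho_ge0 v)) normfV kE normrM (gtr0_norm k_gt0).
  rewrite mulrC ler_wpM2r ?rho_ge0// lef_pV2 ?posrE ?mulr_gt0//.
    by rewrite ler_pM2l// ltW.
  by rewrite (lt_trans e0).
Qed.

Lemma reflect_integral (G : R -> R) (a b : R) : a <= b ->
  {within `[c + c - b, c + c - a], continuous G} ->
  (\int[leb]_(x in `[(c + c - b)%R, (c + c - a)%R]) (G x)%:E =
   \int[leb]_(x in `[a, b]) (G (c + c - x)%R)%:E)%E.
Proof.
move=> ab cG; pose F := fun x : R => c + c - x.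
have dF (x : R) : is_derive x 1 F (-1).
  by apply: is_derive_eq; rewrite /GRing.scale/=; ring.
have DF : F^`()%classic = cst (-1).
  by apply/funext => z; rewrite derive1E; have := dF z; move=> H; rewrite derive_val.
have cF : continuous F.
  by move=> z; apply: cvgB; [exact: cvg_cst|exact: cvg_id].
rewrite (@integration_by_substitution_decreasing _ F)//.
- apply: eq_integral => x _; congr EFin.
  by rewrite !fctE DF/= opprK mulr1.
- by move=> x y _ _ xy; rewrite /F ltrD2l ltrN2.
- by rewrite DF => ? _; exact: cvg_cst.
- by rewrite DF; exact: is_cvg_cst.
- by rewrite DF; exact: is_cvg_cst.
- split => //.
  + by apply: cvg_at_right_filter; exact: cF.
  + by apply: cvg_at_left_filter; exact: cF.
Qed.

Let annulus eps : 0 < eps -> eps < rr ->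
  outer eps = outer rr `|`
    (`]c + eps, c + rr]%classic `|` `[c - rr, c - eps[%classic).
Proof.
move=> e0 er; apply/seteqP; split => v; rewrite /outer/= !in_itv/=.
  have [rv|vr] := ltP rr `|v - c|; first by left.
  move=> ev; right; move: vr; rewrite ler_norml => /andP[v1 v2].
  move: ev; rewrite ltr_normr => /orP[?|?].
    by left; apply/andP; split; lra.
  by right; apply/andP; split; lra.
rewrite !ltr_normr => -[H|[/andP[? ?]|/andP[? ?]]].
- by case/orP: H => ?; apply/orP; [left|right]; lra.
- by apply/orP; left; lra.
- by apply/orP; right; lra.
Qed.

Let itvR eps v : v \in `[c + eps, c + rr] -> 0 < eps ->
  (v \in `[c - rr, c + rr]) /\ (c + c - v \in `[c - rr, c + rr]).
Proof.
rewrite !in_itv/= => /andP[? ?] ?.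
by split; apply/andP; split; lra.
Qed.

(** Pairing [x] with its mirror image about [c] cancels the singularity: the two kernel values add
    up to [(rho x - rho (2c - x)) / (k (x - c))], bounded by [2 * Lp / k] over a length at most
    [rr]. The bound is uniform in [eps]. *)
Lemma annulus_integral eps : 0 < eps -> eps < rr ->
  `|\int[leb]_(v in outer eps) h v - \int[leb]_(v in outer rr) h v|
  <= 2 * Lp * rr / k.
Proof.
move=> e0 er.
have rr0 : 0 < rr by exact: lt_trans er.
have iA : leb.-integrable (`]c + eps, c + rr]%classic : set Rm) (EFin \o h).
  apply: (integrableS (m_outer eps)) (integrable_outer _ e0) => //.
  by rewrite annulus// => v ?; right; left.
have iB : leb.-integrable (`[c - rr, c - eps[%classic : set Rm) (EFin \o h).
  apply: (integrableS (m_outer eps)) (integrable_outer _ e0) => //.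
  by rewrite annulus// => v ?; right; right.
have iAB : leb.-integrable
   (`]c + eps, c + rr]%classic `|` `[c - rr, c - eps[%classic : set Rm) (EFin \o h).
  apply: (integrableS (m_outer eps)) (integrable_outer _ e0) => //.
  - exact: measurableU.
  - by rewrite annulus// => v ?; right.
have i0 := integrable_outer _ e0.
rewrite [in outer eps]annulus// in i0 *.
rewrite Rintegral_setU//; last 2 first.
- exact: measurableU.
- apply/disj_setPS => v [] /=; rewrite /outer/= !in_itv/= ltNge ler_norml.
  by move=> /negP H [/andP[? ?]|/andP[? ?]]; apply: H; apply/andP; split; lra.
rewrite addrC addKr Rintegral_setU//; last first.
  apply/disj_setPS => v [] /=; rewrite !in_itv/=.
  by move=> /andP[? ?] /andP[? ?]; lra.
rewrite Rintegral_itv_obnd_cbnd// Rintegral_itv_bndo_bndc//.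
have ch v : v != c -> {for v, continuous h}.
  move=> vc; apply: cvgM; first exact: continuous_rho.
  apply: cvgV; first by rewrite kE mulf_neq0 ?subr_eq0// gt_eqF.
  by apply: cvgB; [apply: cvgM; [exact: cvg_cst|exact: cvg_id]|exact: cvg_cst].
have cA : {within `[c + eps, c + rr], continuous h}.
  apply: continuous_in_subspaceT => v; rewrite inE/= in_itv/= => /andP[v1 _].
  by apply: ch; apply/eqP; lra.
have cB : {within `[c - rr, c - eps], continuous h}.
  apply: continuous_in_subspaceT => v; rewrite inE/= in_itv/= => /andP[_ v1].
  by apply: ch; apply/eqP; lra.
have cB' : {within `[c + eps, c + rr], continuous (fun x => h (c + c - x))}.
  apply: continuous_in_subspaceT => v; rewrite inE/= in_itv/= => /andP[v1 _].
  apply: (@continuous_comp _ _ _ (fun x => c + c - x) h).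
    by apply: cvgB; [exact: cvg_cst|exact: cvg_id].
  by apply: ch; apply/eqP; lra.
have -> : \int[leb]_(x in `[c - rr, c - eps]) h x =
    \int[leb]_(x in `[c + eps, c + rr]) h (c + c - x).
  rewrite /Rintegral; congr fine.
  have -> : c - rr = c + c - (c + rr) by ring.
  have -> : c - eps = c + c - (c + eps) by ring.
  apply: reflect_integral; first by lra.
  have -> : c + c - (c + rr) = c - rr by ring.
  by have -> : c + c - (c + eps) = c - eps by ring.
have jA := continuous_compact_integrable (@segment_compact _ _ _) cA.
have jB := continuous_compact_integrable (@segment_compact _ _ _) cB'.
rewrite -RintegralD//.
have jD : leb.-integrable (`[c + eps, c + rr]%classic : set Rm)
    (EFin \o (fun x => h x + h (c + c - x))).
  by have := integrableD _ jA jB; exact.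
rewrite (le_trans (le_normr_Rintegral _ jD))//.
(* The sign of [Lp] is read off the Lipschitz bound at two distinct points. *)
have B0 : 0 <= 2 * Lp / k.
  have cc : c \in `[c - rr, c + rr] by rewrite in_itv/=; apply/andP; split; lra.
  have cr : c + rr \in `[c - rr, c + rr] by rewrite in_itv/=; apply/andP; split; lra.
  have := le_trans (normr_ge0 _) (rho_lip _ _ cr cc).
  rewrite (_ : c + rr - c = rr); last by ring.
  rewrite (gtr0_norm rr0) pmulr_lge0// => Lp0.
  by rewrite divr_ge0// ?mulr_ge0// ltW.
apply: (@le_trans _ _ (\int[leb]_(x in `[c + eps, c + rr]) (2 * Lp / k))).
  apply: le_Rintegral => //.
  - exact: integrable_norm jD.
  - apply/integrableP; split; first exact: measurable_cst.
    rewrite integral_cst//= lebesgue_measure_itv/= lte_fin ltrD2l er.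
    by rewrite -EFinB -EFinM ltry.
  move=> x; rewrite /= => xI; have [x1 x2] := itvR _ _ xI e0.
  have xc : 0 < x - c by move: xI; rewrite in_itv/= => /andP[? ?]; lra.
  have -> : h x + h (c + c - x) = (rho x - rho (c + c - x)) / (k * (x - c)).
    rewrite /h !kE (_ : c + c - x - c = - (x - c)); last by ring.
    by rewrite mulrN invrN mulrN mulrBl.
  rewrite normrM normfV (gtr0_norm (mulr_gt0 k_gt0 xc)).
  rewrite ler_pdivrMr ?mulr_gt0// (le_trans (rho_lip _ _ x1 x2))//.
  rewrite (_ : x - (c + c - x) = 2 * (x - c)); last by ring.
  rewrite gtr0_norm ?mulr_gt0// le_eqVlt; apply/orP; left; apply/eqP.
  by field; rewrite gt_eqF.
rewrite Rintegral_cst//= lebesgue_measure_itv/= lte_fin ltrD2l er/=.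
rewrite [leRHS](_ : _ = 2 * Lp / k * rr); last by rewrite mulrAC.
by rewrite ler_wpM2l//; lra.
Qed.

End Kernel.

Lemma rho_hat_truncated (lam : R) (M : nat) (e r Lp : R) :
  let k := kappa lam M in 0 < k -> 0 < r ->
  (forall u v, u \in `[e / k - r / k, e / k + r / k] ->
    v \in `[e / k - r / k, e / k + r / k] -> `|rho u - rho v| <= Lp * `|u - v|) ->
  rho_hat lam M e = 1 ->
  `|\int[leb]_(v in [set v : R | r / k < `|v - e / k|]) (rho v / (k * v - e)) - 1|
    <= 2 * Lp * (r / k) / k.
Proof.
move=> k k0 r0 lip h1.
set f := fun eps => \int[leb]_(v in [set v : R | eps < `|v - e / k|])
  (rho v / (k * v - e)).
have cf : f eps @[eps --> 0^'+] --> (1 : R).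
  (* A divergent [lim] takes the default value 0; since the value here is 1, the principal value
     truly converges. *)
  rewrite -h1 /rho_hat; apply: cvgNpoint.
  by move: h1; rewrite /rho_hat => ->; exact: oner_neq0.
rewrite -/(f (r / k)) distrC; apply/ler_addgt0Pr => eta eta0.
have rk0 : 0 < r / k by rewrite divr_gt0.
have nr : \forall eps \near (0 : R)^'+, 0 < eps /\ eps < r / k.
  near=> eps; split; first by near: eps; exact: nbhs_right_gt.
  by near: eps; exact: nbhs_right_lt.
have /cvgrPdist_lt/(_ _ eta0) nf := cf.
have [eps [[e0 er] fe]] := filter_ex (filterI nr nf).
have := annulus_integral _ _ _ _ k0 lip _ e0 er; rewrite -/(f eps) -/(f (r / k)).
move=> H; have -> : 1 - f (r / k) = (1 - f eps) + (f eps - f (r / k)) by ring.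
by rewrite (le_trans (ler_normD _ _))// addrC lerD// ltW.
Unshelve. all: by end_near. Qed.

End PrincipalValue.

(** * The good event *)

Lemma measurable_holds d (T : measurableType d) (f : T -> bool) :
  measurable_fun setT f -> measurable [set x | f x].
Proof.
move=> mf; rewrite (_ : [set x | f x] = setT `&` f @^-1` [set true]).
  exact: mf.
by rewrite setTI; apply/seteqP; split.
Qed.

Section GoodEvent.
Context d {T : measurableType d} {R : realType} (P : probability T R)
  (M : nat) (X : 'I_M -> {RV P >-> R}) (lam E e : R).
Local Notation Rm := (measurableTypeR R).
Local Notation leb := (@lebesgue_measure R).
Local Notation gauss := (@normal_prob R 0 1).
Let k := kappa lam M.
Let D := Delta lam M E.
Let tauM := (e - E) / D.
Let z (v : R) : R := (k * v - e) / D.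
Variables (r s t delta Q c : R) (J : nat).
Hypothesis hX : iid_std_gaussian X.
Hypotheses (M_gt0 : (0 < M)%N) (k_gt0 : 0 < k) (D_gt0 : 0 < D).
Hypotheses (r_gt0 : 0 < r) (r_le : r <= 8^-1) (e_near : `|e + 1| <= 4^-1).
Hypothesis s_ge0 : 0 <= s.
Hypothesis rho_le_s : forall v : R, `|k * v - e| <= r -> rho v <= s.
Hypothesis rho_hat_e : rho_hat lam M e = 1.
Hypotheses (delta_gt0 : 0 < delta) (delta_le1 : delta <= 1) (t_ge1 : 1 <= t).
Hypotheses (Dt_le : D * (2 * t + 2) <= r) (DJ_ge : r <= D * 2 ^+ J).
Hypotheses (Q_gt0 : 0 < Q) (c_gt0 : 0 < c).
Let q := D * s / k.

Let zD v : k * v - e = D * z v.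
Proof. by rewrite /z; field; rewrite gt_eqF. Qed.

Let m_affine : measurable_fun [set: Rm] (fun v : R => k * v - e).
Proof. by apply: measurable_funB => //; exact: measurable_funM. Qed.

Let m_z : measurable_fun [set: Rm] z.
Proof. exact: measurable_funM. Qed.

Let m_set (f g : Rm -> R) : measurable_fun setT f -> measurable_fun setT g ->
  measurable [set v : Rm | f v <= g v] /\ measurable [set v : Rm | f v < g v].
Proof.
move=> mf mg; split; apply: measurable_holds.
  exact: measurable_fun_ler.
exact: measurable_fun_ltr.
Qed.

Let q_ge0 : 0 <= q.
Proof. exact: divr_ge0 (mulr_ge0 (ltW D_gt0) s_ge0) (ltW k_gt0). Qed.

(* Near the reference energy a unit of rescaled potential carries mass at most
   [q]. *)
Let near_prob (S : set Rm) (x h : R) : measurable S -> 0 <= h ->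
  (forall v, S v -> `|z v - x| <= h /\ `|k * v - e| <= r) ->
  (gauss S <= (2 * h * q)%:E)%E.
Proof.
move=> mS h0 Sz; have Dh : 0 <= D * h by rewrite mulr_ge0// ltW.
have zx v : D * (z v - x) = k * v - e - D * x by rewrite mulrBr -zD.
have := @normal_prob_le R S ((e + D * x - D * h) / k) ((e + D * x + D * h) / k) s mS.
have -> : s * ((e + D * x + D * h) / k - (e + D * x - D * h) / k) = 2 * h * q.
  by rewrite /q; field; rewrite gt_eqF.
apply => //.
- move=> v /Sz[zv _]; rewrite /= in_itv/= ler_pdivrMr// ler_pdivlMr//.
  move: zv; rewrite -(ler_pM2l D_gt0) -[X in X * `|_|](gtr0_norm D_gt0) -normrM zx.
  by rewrite ler_norml => /andP[? ?]; apply/andP; split; lra.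
- by rewrite ler_pM2r ?invr_gt0//; lra.
- by move=> v /Sz[_ /rho_le_s].
Qed.

Let near_z v : `|z v| <= 2 * t + 2 -> `|k * v - e| <= r.
Proof.
move=> h; rewrite zD normrM (gtr0_norm D_gt0) (le_trans _ Dt_le)//.
by rewrite ler_pM2l.
Qed.

Let markov_indic (S : set Rm) (p a : R) : measurable S ->
  (gauss S <= p%:E)%E -> 0 < a ->
  (P [set w | (a <= \sum_i \1_S (X i w))%R] <= (M%:R * p / a)%:E)%E.
Proof.
move=> mS Sp a0; have := @markov_sum _ _ _ P _ X hX (\1_S) p a.
rewrite card_ord => /(_ (measurable_indic mS)); apply => //.
by rewrite integral_indic// setIT.
Qed.

Let m_sum (f : Rm -> R) : measurable_fun setT f ->
  measurable_fun setT (fun w => \sum_i f (X i w)).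
Proof.
move=> mf; apply: measurable_sum => i.
apply: (@measurableT_comp _ _ _ _ Rm _ f) => //.
exact: measurable_funP (X i).
Qed.

Let m_ge (f : T -> R) (a : R) : measurable_fun setT f ->
  measurable [set w | a <= f w].
Proof.
move=> mf; apply: measurable_holds; exact: measurable_fun_ler.
Qed.

Let far := [set v : Rm | r < `|k * v - e|].
Let m_far : measurable far.
Proof. by apply: (m_set _ _ _ _).2 => //; exact: measurableT_comp. Qed.

(** Kernel truncated at macroscopic distance [r]: being bounded by [1 / r], its sum is accessible to
    Chebyshev. *)
Let g0 (v : Rm) : R := \1_far v * (k * v - e)^-1.

Let g0_le v : `|g0 v| <= r^-1.
Proof.
rewrite /g0 indicE; have [H|_] := boolP (v \in far).
  rewrite mul1r normfV lef_pV2 ?posrE//; last first.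
    by move: H; rewrite inE => H; exact: lt_trans r_gt0 H.
  by move: H; rewrite inE => /ltW.
by rewrite mul0r normr0 invr_ge0 ltW.
Qed.

Let m_g0 : measurable_fun setT g0.
Proof.
apply: measurable_funM; first exact: measurable_indic.
by apply: measurableT_comp => //; exact: measurable_invr.
Qed.

Let mean := fine (\int[gauss]_v (g0 v)%:E).

Let int_g0 : gauss.-integrable setT (EFin \o g0).
Proof. exact: (@bounded_integrable _ _ _ _ _ r^-1). Qed.

Let meanE : (\int[gauss]_v (g0 v)%:E = mean%:E)%E.
Proof. by rewrite /mean fineK//; exact: integrable_fin_num. Qed.

Let mean_le : `|mean| <= r^-1.
Proof.
rewrite -lee_fin -abse_EFin -meanE.
rewrite (le_trans (le_abse_integral _ measurableT (measurable_int _ int_g0)))//.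
apply: (@le_trans _ _ (\int[gauss]_v (cst (r^-1)%:E) v)%E).
  apply: ge0_le_integral => //.
  - by apply: measurableT_comp => //; exact: measurable_int int_g0.
  - by move=> v _ /=; rewrite lee_fin g0_le.
by rewrite integral_cst// [X in (_ * X)%E]probability_setT mule1.
Qed.

(** The equation [rho_hat = 1] with the neighbourhood of the singularity cut out, which costs little
    by symmetry. The constant is [2 * Lp * (r / k) / k] with [Lp = 2 * s / k]. *)
Let mean_near1 : `|mean - 1| <= 4 * s * r / k ^+ 3.
Proof.
have -> : mean = \int[leb]_(v in [set v : R | r / k < `|v - e / k|])
    (rho v / (k * v - e)).
  rewrite /mean (integral_normal _ r^-1)//.
  rewrite /Rintegral [in RHS]integral_mkcond; congr fine.
  apply: eq_integral => v _; rewrite patchE /g0 indicE.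
  have -> : (v \in far) = (v \in [set v : R | r / k < `|v - e / k|]).
    apply/idP/idP; rewrite !inE/= ltr_pdivrMr// -[X in _ < _ * X](gtr0_norm k_gt0).
      by rewrite -normrM mulrBl divfK ?gt_eqF// [v * k]mulrC.
    by rewrite -normrM mulrBl divfK ?gt_eqF// [v * k]mulrC.
  by case: ifP => _; rewrite ?mul1r ?mul0r// mulrC.
(* On this interval [|k * v| <= 2], as [e] is near [-1], and [rho v <= s]. *)
have Lv (v : R) : v \in `[e / k - r / k, e / k + r / k] -> `|v * rho v| <= 2 * s / k.
  rewrite in_itv/= -mulrBl -mulrDl ler_pdivrMr// ler_pdivlMr// => /andP[v1 v2].
  have nv : `|k * v - e| <= r by rewrite ler_norml; apply/andP; split; lra.
  rewrite normrM mulrAC ler_pM ?(ger0_norm (rho_ge0 v)) ?rho_ge0 ?rho_le_s//.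
  rewrite ler_pdivlMr// -[X in _ * X](gtr0_norm k_gt0) -normrM.
  move: e_near r_le; rewrite !ler_norml => /andP[? ?] ?.
  by apply/andP; split; lra.
have := rho_hat_truncated lam M e r (2 * s / k) k_gt0 r_gt0 _ rho_hat_e.
move=> /(_ (rho_lipschitz _ _ _ Lv)) H; rewrite (le_trans H)//.
by rewrite le_eqVlt; apply/orP; left; apply/eqP; rewrite -/k; field; rewrite gt_eqF.
Qed.

Let g (v : Rm) : R := g0 v - mean.

Let m_g : measurable_fun setT g.
Proof. exact: measurable_funB. Qed.

Let bad1 := [set w | c <= `|\sum_i g (X i w)|].

Let bad1_prob : (P bad1 <= (4 * M%:R / (r ^+ 2 * c ^+ 2))%:E)%E.
Proof.
have gb v : `|g v| <= 2 / r.
  rewrite (le_trans (ler_normB _ _))//; have := g0_le v; have := mean_le.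
  by move=> *; lra.
have := @chebyshev_sum _ _ _ P _ X hX g (2 / r) c m_g gb.
rewrite card_ord.
have -> : M%:R * (2 / r) ^+ 2 / c ^+ 2 = 4 * M%:R / (r ^+ 2 * c ^+ 2).
  by field; rewrite !gt_eqF.
apply => //; rewrite /g.
under eq_integral do rewrite EFinB.
rewrite integralB//; last exact: (finite_measure_integrable_cst gauss mean).
by rewrite meanE integral_cst// [X in (_ * X)%E]probability_setT mule1 subee.
Qed.

Let tail := [set v : Rm | 2^-1 < `|k * v|].

Let m_tail : measurable tail.
Proof.
by apply: (m_set _ _ _ _).2 => //; apply: measurableT_comp => //.
Qed.

Let bad2 := [set w | (M%:R / 2 : R) <= \sum_i (\1_tail (X i w) : R)].

Let bad2_prob : (P bad2 <= (2 * fine (gauss tail))%:E)%E.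
Proof.
have h : (gauss tail <= (fine (gauss tail))%:E)%E by rewrite fineK// fin_num_measure.
have := markov_indic _ _ _ m_tail h; rewrite /bad2.
move=> /(_ (M%:R / 2)); rewrite divr_gt0 ?ltr0n// => /(_ isT).
congr (_ <= _%:E)%E; field; by rewrite pnatr_eq0 -lt0n.
Qed.

Let near := [set v : Rm | `|k * v - e| <= r].
Let m_near : measurable near.
Proof. by apply: (m_set _ _ _ _).1 => //; exact: measurableT_comp. Qed.

Let f3 (v : Rm) : R := \1_near v * (Num.max `|z v| 1)^-1.

Let scale (j : nat) := [set v : Rm | `|z v| <= 2 ^+ j] `&` near.

Let m_scale j : measurable (scale j).
Proof.
apply: measurableI => //; apply: (m_set _ _ _ _).1 => //.
exact: measurableT_comp.
Qed.

Let f3_ge0 v : 0 <= f3 v.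
Proof. by rewrite mulr_ge0// invr_ge0 le_max ler01 orbT. Qed.

Let m_f3 : measurable_fun setT f3.
Proof.
apply: measurable_funM; first exact: measurable_indic.
apply: measurableT_comp; first exact: measurable_invr.
by apply: measurable_maxr => //; exact: measurableT_comp.
Qed.

(** Dyadic layering: the term of the least scale [j] containing [v] already dominates. Each weighted
    scale has mass at most [4 * q], so the near sum costs only a factor [J + 1], the number of
    scales. *)
Let f3_le v : f3 v <= \sum_(j < J.+1) 2 / 2 ^+ j * \1_(scale j) v.
Proof.
have t0 (j : 'I_J.+1) : 0 <= 2 / 2 ^+ j * \1_(scale j) v.
  by rewrite mulr_ge0// divr_ge0// exprn_ge0.
rewrite /f3 indicE; have [|_] := boolP (v \in near); last first.
  by rewrite mul0r sumr_ge0.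
rewrite inE mul1r => nv.
have zJ : `|z v| <= 2 ^+ J.
  rewrite -(ler_pM2l D_gt0) (le_trans _ DJ_ge)// -[X in X * `|_|](gtr0_norm D_gt0).
  by rewrite -normrM -zD.
have [|j zj jmin] := @ex_minnP (fun j => `|z v| <= 2 ^+ j); first by exists J.
have jJ : (j < J.+1)%N by rewrite ltnS jmin.
rewrite (bigD1 (Ordinal jJ))//= -[leLHS]addr0 lerD ?sumr_ge0//.
rewrite indicE mem_set ?mulr1//.
case: j zj jmin {jJ} => [|j] zj jmin.
  rewrite expr0 divr1; apply: (@le_trans _ _ 1); last by rewrite ler1n.
  by rewrite -[leRHS]invr1 lef_pV2 ?posrE ?le_max ?lexx ?orbT// lt_max ltr01 orbT.
have zj' : 2 ^+ j < `|z v|.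
  by rewrite ltNge; apply/negP => /jmin; rewrite ltnn.
rewrite exprS invfM mulrA divff// mul1r lef_pV2 ?posrE ?exprn_gt0//.
by rewrite le_max ltW.
Qed.

Let f3_int : (\int[gauss]_v (f3 v)%:E <= (4 * J.+1%:R * q)%:E)%E.
Proof.
have ms (j : 'I_J.+1) : measurable_fun setT (fun v : Rm => (2 / 2 ^+ j * \1_(scale j) v)%:E).
  by apply/measurable_EFinP/measurable_funM => //; exact: measurable_indic.
have s0 (j : 'I_J.+1) (v : Rm) : (0 <= (2 / 2 ^+ j * \1_(scale j) v)%:E)%E.
  by rewrite lee_fin mulr_ge0// divr_ge0// exprn_ge0.
apply: (@le_trans _ _ (\int[gauss]_v
    \sum_(j < J.+1) (2 / 2 ^+ j * \1_(scale j) v)%:E)%E).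
  apply: ge0_le_integral => //.
  - by move=> v _; rewrite lee_fin f3_ge0.
  - exact/measurable_EFinP.
  - exact: emeasurable_sum.
  - by move=> v _; rewrite sumEFin lee_fin f3_le.
rewrite ge0_integral_sum//.
apply: (@le_trans _ _ (\sum_(j < J.+1) (4 * q)%:E)%E); last first.
  by rewrite sumEFin sumr_const card_ord lee_fin -mulrnAl mulr_natr.
apply: lee_sum => j _; under eq_integral do rewrite EFinM.
rewrite ge0_integralZl//; last by apply/measurable_EFinP; exact: measurable_indic.
rewrite integral_indic// setIT.
have j0 : (0 : R) < 2 ^+ j by rewrite exprn_gt0.
have -> : 4 * q = 2 / 2 ^+ j * (2 * 2 ^+ j * q) by field; rewrite gt_eqF.
rewrite [leRHS]EFinM; apply: lee_wpmul2l; first by rewrite lee_fin divr_ge0// ltW.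
apply: (near_prob _ 0) => //.
by move=> v [/= zv nv]; rewrite subr0.
Qed.

Let bad3 := [set w | Q <= \sum_i f3 (X i w)].

Let bad3_prob : (P bad3 <= (4 * J.+1%:R * (M%:R * q) / Q)%:E)%E.
Proof.
have := @markov_sum _ _ _ P _ X hX f3 _ Q m_f3 f3_ge0 f3_int Q_gt0.
by rewrite card_ord mulrCA.
Qed.

Let close := [set v : Rm | `|z v| < 2 * delta].

Let m_close : measurable close.
Proof. by apply: (m_set _ _ _ _).2 => //; exact: measurableT_comp. Qed.

Let bad4 := [set w | (1 : R) <= \sum_i (\1_close (X i w) : R)].

Let bad4_prob : (P bad4 <= (4 * delta * (M%:R * q))%:E)%E.
Proof.
have h : (gauss close <= (2 * (2 * delta) * q)%:E)%E.
  apply: (near_prob _ 0) => //; first by rewrite mulr_ge0// ltW.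
  move=> v /ltW zv; rewrite subr0; split => //.
  by apply: near_z; move: t_ge1 delta_le1 => *; lra.
have := markov_indic _ _ _ m_close h ltr01.
by congr (_ <= _%:E)%E; field.
Qed.

Let pairs := [set ab : Rm * Rm | `|z ab.1| <= t + 1 /\ `|z ab.1 - z ab.2| < delta].

Let m_pairs : measurable pairs.
Proof.
have m1 : measurable_fun [set: (Rm * Rm)%type] (fun ab => z ab.1).
  by apply: measurableT_comp => //; exact: measurable_fst.
have m2 : measurable_fun [set: (Rm * Rm)%type] (fun ab => z ab.2).
  by apply: measurableT_comp => //; exact: measurable_snd.
apply: measurableI.
  apply: measurable_holds; apply: measurable_fun_ler => //.
  exact: measurableT_comp.
apply: measurable_holds; apply: measurable_fun_ltr => //.
by apply: measurableT_comp => //; exact: measurable_funB.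
Qed.

Let bad5_exists : exists2 B, measurable B /\
    (P B <= (4 * (t + 1) * delta * (M%:R * q) ^+ 2)%:E)%E &
  forall w, ~ B w -> forall i j, i != j -> ~ pairs (X i w, X j w).
Proof.
pose S := [set v : Rm | `|z v| <= t + 1].
have mS : measurable S by apply: (m_set _ _ _ _).1 => //; exact: measurableT_comp.
have gS : (gauss S <= (2 * (t + 1) * q)%:E)%E.
  apply: (near_prob _ 0) => //; first by move: t_ge1 => *; lra.
  move=> v Sv; rewrite subr0; split => //; apply: near_z.
  by move: Sv t_ge1; rewrite /S/= => *; lra.
have b0 : 0 <= 2 * delta * q.
  by apply: mulr_ge0 => //; rewrite mulr_ge0// ltW.
have b1 : 0 <= 2 * (t + 1) * q.
  by apply: mulr_ge0 => //; move: t_ge1 => *; lra.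
have [||B [mB PB] hB] := @pair_union_le _ _ _ P _ X pairs
    (2 * delta * q * (2 * (t + 1) * q)) m_pairs.
- move=> i j ij.
  apply: (le_trans (@pair_prob_le _ _ _ P _ X hX i j ij pairs S _ m_pairs mS b0 _ _)).
  + by move=> a v [].
  + move=> a Sa; apply: (near_prob _ (z a)) => //.
    * exact: measurable_xsection.
    * exact: ltW.
    * move=> v; rewrite /xsection/= inE => -[/= _ av]; split.
        by rewrite distrC ltW.
      apply: near_z; move: Sa t_ge1 delta_le1; rewrite /S/= => *.
      have := ler_normB (z a) (z a - z v); rewrite subKr => *; lra.
  by rewrite [leRHS]EFinM; apply: lee_wpmul2l; rewrite ?lee_fin.
- exact: mulr_ge0.
exists B => //; split => //; rewrite (le_trans PB)// lee_fin card_ord.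
by rewrite le_eqVlt; apply/orP; left; apply/eqP; ring.
Qed.

Let diag := [set ab : Rm * Rm | ab.1 = ab.2].

(** Ties are excluded among all sites, also outside the window, because the secular equation needs
    an injective potential. *)
Let bad6_exists : exists2 B, measurable B /\ (P B <= 0)%E &
  forall w, ~ B w -> forall i j, i != j -> ~ diag (X i w, X j w).
Proof.
have m_diag : measurable diag.
  have m1 : measurable_fun [set: (Rm * Rm)%type] (fun ab => ab.1 : R).
    exact: measurable_fst.
  have m2 : measurable_fun [set: (Rm * Rm)%type] (fun ab => ab.2 : R).
    exact: measurable_snd.
  have := measurable_holds _ _ _ (measurable_fun_eqr m1 m2).
  by congr measurable; apply/seteqP; split => -[a b] /= /eqP.
have [||B [mB PB] hB] := @pair_union_le _ _ _ P _ X diag 0 m_diag.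
- move=> i j ij.
  apply: (le_trans (@pair_prob_le _ _ _ P _ X hX i j ij diag setT 0 m_diag _ _ _ _)) => //.
  + move=> a _; rewrite (_ : xsection diag a = [set a]); last first.
      by apply/seteqP; split => b; rewrite /xsection/= inE.
    by rewrite /normal_prob integral_set1.
  by rewrite mul0e.
- by [].
by exists B => //; split => //; rewrite (le_trans PB)// mulr0.
Qed.

Let m := M%:R * D ^+ 2 / 8.
(** [D * c] bounds the fluctuation of the far sum, the second term its bias [M * D * |mean - 1|]. *)
Let K1 := D * c + 4 * r * (M%:R * q) / k ^+ 2.
Let K2 := (2 * t + 3) / delta * Q.
Let S := 4 * M%:R * D ^+ 2 / r ^+ 2.
Hypothesis K_small : K1 + K2 < delta * m.

Lemma good_event : exists2 B, measurable B /\
    (P B <= (4 * M%:R / (r ^+ 2 * c ^+ 2)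
      + 2 * fine (gauss [set v | 2^-1 < `|k * v|])
      + 4 * J.+1%:R * (M%:R * q) / Q
      + 4 * delta * (M%:R * q)
      + 4 * (t + 1) * delta * (M%:R * q) ^+ 2)%:E)%E &
  forall w, ~ B w -> let v := fun x => X x w in
    let n := label_at lam M E v tauM in
    [/\ labelled lam E v n, `|eig lam E v n - tauM| <= delta,
        Num.sqrt m * delta <= norm_ratio lam E v n &
        forall n', n' <> n -> labelled lam E v n' ->
          `|eig lam E v n'| + `|tauM| <= t ->
          norm_ratio lam E v n' <= 1 + (S + K2 ^+ 2) / (delta * m) ^+ 2].
Proof.
have [B5 [mB5 PB5] hB5] := bad5_exists; have [B6 [mB6 PB6] hB6] := bad6_exists.
have mb1 : measurable bad1.
  by apply: m_ge; apply: measurableT_comp => //; exact: m_sum.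
have mb2 : measurable bad2 by apply/m_ge/m_sum/measurable_indic.
have mb3 : measurable bad3 by exact/m_ge/m_sum.
have mb4 : measurable bad4 by apply/m_ge/m_sum/measurable_indic.
(* The last of the six events is null, so the bound has only five terms. *)
exists (bad1 `|` bad2 `|` bad3 `|` bad4 `|` B5 `|` B6).
  have mU := (measurableU _ _).
  split; first by do 5 (apply: measurableU => //).
  apply: (le_trans (measureU2 _ _ _)) => //; first by do 4 (apply: measurableU => //).
  rewrite -[leRHS]adde0 leeD//.
  apply: (le_trans (measureU2 _ _ _)) => //; first by do 3 (apply: measurableU => //).
  rewrite EFinD leeD//.
  apply: (le_trans (measureU2 _ _ _)) => //; first by do 2 (apply: measurableU => //).
  rewrite EFinD leeD//.
  apply: (le_trans (measureU2 _ _ _)) => //; first by do 1 (apply: measurableU => //).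
  rewrite EFinD leeD//.
  by apply: (le_trans (measureU2 _ _ _)) => //; rewrite EFinD leeD.
move=> w nB v n.
have n1 : ~ bad1 w by move=> h; apply: nB; do 5 left.
have n2 : ~ bad2 w by move=> h; apply: nB; do 4 left; right.
have n3 : ~ bad3 w by move=> h; apply: nB; do 3 left; right.
have n4 : ~ bad4 w by move=> h; apply: nB; do 2 left; right.
have n5 : ~ B5 w by move=> h; apply: nB; left; right.
have n6 : ~ B6 w by move=> h; apply: nB; right.
have v_inj : injective v.
  move=> x y xy; apply/eqP; apply: contraT => nxy.
  by have := hB6 _ n6 _ _ nxy.
have D0 : 0 <= D by exact: ltW.
have far_mean : `|D * \sum_(x | r < `|k * v x - e|) (k * v x - e)^-1 - M%:R * D| <= K1.
  have sE : \sum_(x | r < `|k * v x - e|) (k * v x - e)^-1 =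
      \sum_x g (v x) + M%:R * mean.
    rewrite /g sumrB sumr_const card_ord -[mean *+ M]mulr_natl subrK big_mkcond/=.
    apply: eq_bigr => x _; rewrite /g0 indicE.
    have -> : (v x \in far) = (r < `|k * v x - e|).
      by apply/idP/idP; rewrite inE.
    by case: ifP; rewrite ?mul1r ?mul0r.
  rewrite sE.
  have -> : D * (\sum_x g (v x) + M%:R * mean) - M%:R * D =
    D * (\sum_x g (v x)) + M%:R * D * (mean - 1) by ring.
  rewrite (le_trans (ler_normD _ _))// lerD//.
    rewrite normrM ger0_norm// ler_wpM2l//.
    by move/negP: n1; rewrite -ltNge => /ltW.
  have MD0 : 0 <= M%:R * D by exact: mulr_ge0.
  rewrite normrM (ger0_norm MD0).
  have -> : 4 * r * (M%:R * q) / k ^+ 2 = M%:R * D * (4 * s * r / k ^+ 3).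
    by rewrite /q; field; rewrite gt_eqF.
  exact: ler_wpM2l.
have bulk : M%:R / 2 <= \sum_(x | `|k * v x| <= 2^-1) (1 : R).
  have : \sum_x (\1_tail (v x) : R) < M%:R / 2.
    by rewrite ltNge; apply/negP.
  have : \sum_(x < M) (1 : R) = M%:R by rewrite sumr_const card_ord.
  rewrite (bigID (fun x => `|k * v x| <= 2^-1))/= => H1.
  have <- : \sum_(x | ~~ (`|k * v x| <= 2^-1)) (1 : R) = \sum_x (\1_tail (v x) : R).
    rewrite big_mkcond/=; apply: eq_bigr => x _; rewrite indicE -ltNge.
    have -> : (v x \in tail) = (2^-1 < `|k * v x|).
      by apply/idP/idP; rewrite inE.
    by case: ifP.
  move: H1; lra.
have near_mass : \sum_(x | `|k * v x - e| <= r)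
    (Num.max `|offset lam M E e v x| 1)^-1 <= Q.
  have : \sum_x f3 (v x) < Q by rewrite ltNge; apply/negP.
  move=> /ltW; apply: le_trans; rewrite big_mkcond/=; apply: ler_sum => x _.
  rewrite /f3 indicE.
  have -> : (v x \in near) = (`|k * v x - e| <= r) by apply/idP/idP; rewrite inE.
  by case: ifP; rewrite ?mul1r ?mul0r.
have z_ge x : 2 * delta <= `|offset lam M E e v x|.
  rewrite leNgt; apply/negP => zx; apply: n4; rewrite /bad4/=.
  rewrite (bigD1 x)//= indicE mem_set// lerDl sumr_ge0//.
have z_sep x x' : x != x' -> `|offset lam M E e v x| <= t + 1 ->
    delta <= `|offset lam M E e v x - offset lam M E e v x'|.
  move=> xx zx; rewrite leNgt; apply/negP => zz.
  by apply: (hB5 _ n5 _ _ xx); split.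
have k0 : k != 0 by rewrite gt_eqF.
have [l1 l2 l3] := eig_label_at lam M E e v M_gt0 D_gt0 k0 v_inj r t delta Q K1
  e_near r_le delta_gt0 delta_le1 t_ge1 Dt_le far_mean bulk near_mass z_ge
  K_small.
split=> // n' nn ln' tn'.
exact: (eig_label_other lam M E e v M_gt0 D_gt0 k0 v_inj r t delta Q K1
  e_near r_gt0 r_le delta_gt0 delta_le1 t_ge1 Dt_le far_mean bulk near_mass z_ge
  z_sep K_small).
Qed.

End GoodEvent.

(** * Size estimates *)

Section WindowEstimates.
Context {R : realType}.
Variables (lam : R) (M : nat) (E e eta r t : R).
Let L : R := ln M%:R.
Let k := kappa lam M.
Let D := Delta lam M E.
(** [a], [A] and [B] are [M ^ (eta / 2)], [M ^ eta] and [M ^ beta]. Constants and logarithms are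
    absorbed into [a], and [a * a = A]. *)
Let a := expR (eta / 2 * L).
Let A := expR (eta * L).
Let beta := 1 / lam ^+ 2 - 1 / 2.
Let B := expR (beta * L).
(** The value of [exp (- v ^+ 2 / 2)] where [k * v = e + r], the point of the near interval closest
    to the origin. *)
Let s := expR (- ((- e - r) ^+ 2 / lam ^+ 2 * L)).
Hypotheses (lam_gt1 : 1 < lam) (M_ge2 : (2 <= M)%N) (eta_gt0 : 0 < eta).
Hypotheses (eta_beta : 20 * eta <= beta) (eta_lam : eta <= 1 - 1 / lam ^+ 2).
Hypotheses (r_gt0 : 0 < r) (r_le : r <= 8^-1) (r_eta : 6 * r <= eta) (t_ge1 : 1 <= t).
Hypotheses (E_near : `|E ^+ 2 - 1| <= eta / 4) (e_near : `|e + 1| <= 4^-1).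
Hypothesis Ee_near : E ^+ 2 - (- e - r) ^+ 2 <= 3 * r.
Hypotheses (L_ge1 : 1 <= L) (L_le : L <= a) (pi_le : 2 * pi <= a) (A_ge64 : 64 <= A).
Hypotheses (A_ge_t : 2 * t + 3 <= A) (A_ge_tr : (2 * t + 2) ^+ 2 <= r ^+ 2 * A).
Hypothesis A_ge_r : 4 <= r ^+ 2 * A.

Let lam_gt0 : 0 < lam. Proof. exact: lt_trans lam_gt1. Qed.
Let lam2_gt0 : 0 < lam ^+ 2. Proof. exact: exprn_gt0. Qed.
Let lam2V_le1 : (lam ^+ 2)^-1 <= 1.
Proof. by rewrite invf_le1// exprn_ege1// ltW. Qed.
Let L_gt0 : 0 < L. Proof. exact: lt_le_trans L_ge1. Qed.
Let M_gt0 : 0 < M%:R :> R. Proof. by rewrite ltr0n ltnW. Qed.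
Let ME : M%:R = expR L. Proof. by rewrite lnK// posrE. Qed.
Let aaE : a * a = A.
Proof. by rewrite /a /A -expRD; congr expR; field. Qed.
Let a_gt0 : 0 < a. Proof. exact: expR_gt0. Qed.
Let A_gt0 : 0 < A. Proof. exact: expR_gt0. Qed.
Let B_gt0 : 0 < B. Proof. exact: expR_gt0. Qed.
Let pi0 : 0 < (pi : R). Proof. exact: pi_gt0. Qed.

Let sqrt2L_gt0 : 0 < Num.sqrt (2 * L).
Proof. by rewrite sqrtr_gt0 mulr_gt0. Qed.

Lemma window_kappa_gt0 : 0 < k.
Proof. by rewrite divr_gt0. Qed.

Lemma window_kappa_sqr : k ^+ 2 = lam ^+ 2 / (2 * L).
Proof. by rewrite /k /kappa expr_div_n sqr_sqrtr// mulr_ge0// ltW. Qed.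

Let k_gt0 := window_kappa_gt0.

Let sqrt2pi_gt0 : 0 < Num.sqrt (2 * pi : R).
Proof. by rewrite sqrtr_gt0 mulr_gt0. Qed.

Let half_sqr (x : R) : (x / k) ^+ 2 / 2 = x ^+ 2 / lam ^+ 2 * L.
Proof.
rewrite expr_div_n window_kappa_sqr; field.
by rewrite !gt_eqF.
Qed.

Let rho_E : rho (E / k) = expR (- (E ^+ 2 / lam ^+ 2 * L)) / Num.sqrt (2 * pi).
Proof. by rewrite /rho mulNr half_sqr. Qed.

Let DE : M%:R * D = k * Num.sqrt (2 * pi) * expR (E ^+ 2 / lam ^+ 2 * L).
Proof.
rewrite /D /Delta -/k rho_E expRN; field.
by rewrite !gt_eqF ?expR_gt0.
Qed.

Lemma window_Delta_gt0 : 0 < D.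
Proof.
by rewrite /D /Delta -/k divr_gt0// mulr_gt0// rho_gt0.
Qed.

Let D_gt0 := window_Delta_gt0.

Lemma window_density (v : R) : `|k * v - e| <= r -> rho v <= s.
Proof.
move=> nv; rewrite (le_trans (rho_le_expR v))// ler_expR.
rewrite mulNr lerN2.
have e0 : 0 <= - e - r.
  by move: e_near r_le; rewrite ler_norml => /andP[? ?] ?; lra.
have h : (- e - r) ^+ 2 <= (k * v) ^+ 2.
  rewrite -[leRHS]real_normK ?num_real// lerXn2r ?nnegrE//.
  move: nv; rewrite ler_norml => /andP[? ?]; rewrite ler_normr.
  by apply/orP; right; lra.
have -> : v ^+ 2 / 2 = (k * v) ^+ 2 / lam ^+ 2 * L.
  by rewrite -half_sqr; congr (_ ^+ 2 / 2); field; rewrite gt_eqF.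
by rewrite ler_pM2r// ler_pM2r ?invr_gt0.
Qed.

Let sqrt2pi_le : Num.sqrt (2 * pi) <= a.
Proof.
have h := pi_ge2 R; rewrite (le_trans _ pi_le)//.
have p0 : 0 <= 2 * pi :> R by lra.
rewrite -[leRHS]ger0_norm// -sqrtr_sqr ler_wsqrtr// expr2 ler_peMr//.
by lra.
Qed.

(** [Delta] is by definition the inverse local density at [E], so the powers of [M] cancel; what
    remains is [sqrt (2 * pi)] times an exponential with exponent at most
    [3 * r * L <= eta / 2 * L]. *)
Lemma window_mass : M%:R * (D * s / k) <= A.
Proof.
have -> : M%:R * (D * s / k) = Num.sqrt (2 * pi) *
    expR ((E ^+ 2 - (- e - r) ^+ 2) / lam ^+ 2 * L).
  rewrite mulrA mulrA DE /s.
  have -> : (E ^+ 2 - (- e - r) ^+ 2) / lam ^+ 2 * L =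
    E ^+ 2 / lam ^+ 2 * L + - ((- e - r) ^+ 2 / lam ^+ 2 * L) by field; rewrite gt_eqF.
  by rewrite expRD; field; rewrite gt_eqF.
rewrite -aaE ler_pM ?(ltW sqrt2pi_gt0) ?expR_ge0// ler_expR ler_pM2r//.
rewrite ler_pdivrMr// (le_trans Ee_near)//.
have : 1 < lam ^+ 2 by rewrite exprn_egt1.
move: r_eta => ? ?; rewrite (@le_trans _ _ (eta / 2 * 1))//.
  by lra.
by rewrite ler_wpM2l// ?ltW// divr_gt0.
Qed.

(** From [M * D ^+ 2 = (M * D) ^+ 2 / M]; the exponent [2 * E ^+ 2 / lam ^+ 2 - 1] is [2 * beta]
    when [E ^+ 2 = 1]. *)
Let MD2E : M%:R * D ^+ 2 = pi * lam ^+ 2 / L *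
  expR (2 * beta * L + 2 * (E ^+ 2 - 1) / lam ^+ 2 * L).
Proof.
have -> : M%:R * D ^+ 2 = (M%:R * D) ^+ 2 / M%:R by field; rewrite gt_eqF.
have MDE := DE; set G := expR _ in MDE.
have -> : (M%:R * D) ^+ 2 = k ^+ 2 * Num.sqrt (2 * pi) ^+ 2 * G ^+ 2.
  by rewrite MDE; ring.
rewrite sqr_sqrtr; last by rewrite mulr_ge0// ltW.
rewrite ME window_kappa_sqr /G -expRM_natl -expRN.
have -> : 2 * beta * L + 2 * (E ^+ 2 - 1) / lam ^+ 2 * L =
    2%:R * (E ^+ 2 / lam ^+ 2 * L) + - L.
  by rewrite /beta; field; rewrite gt_eqF.
by rewrite expRD; field; rewrite gt_eqF.
Qed.

Let E_exp : `|2 * (E ^+ 2 - 1) / lam ^+ 2 * L| <= eta / 2 * L.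
Proof.
rewrite normrM (gtr0_norm L_gt0) ler_pM2r// -mulrA normrM.
rewrite (gtr0_norm (ltr0Sn _ 1)) normrM.
rewrite [`|(lam ^+ 2)^-1|]gtr0_norm ?invr_gt0//.
have : `|E ^+ 2 - 1| * (lam ^+ 2)^-1 <= eta / 4 * 1.
  by rewrite ler_pM// invr_ge0 ltW.
by move=> *; lra.
Qed.

Let BBE : expR (2 * beta * L) = B ^+ 2.
Proof. by rewrite /B -expRM_natl; congr expR; ring. Qed.

Lemma window_spacing_ge : B ^+ 2 / A <= M%:R * D ^+ 2.
Proof.
rewrite MD2E expRD BBE.
have h1 : a^-1 <= expR (2 * (E ^+ 2 - 1) / lam ^+ 2 * L).
  rewrite /a -expRN ler_expR.
  by move: E_exp; rewrite ler_norml => /andP[? ?].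
have h2 : a^-1 <= pi * lam ^+ 2 / L.
  rewrite ler_pdivlMr// ler_pdivrMl//.
  rewrite (le_trans L_le)// ler_peMr//; first exact: ltW.
  have l1 : 1 <= lam ^+ 2 by rewrite exprn_ege1// ltW.
  have p1 := pi_ge2 R.
  by rewrite -[leLHS]mul1r ler_pM//; lra.
have -> : B ^+ 2 / A = a^-1 * (B ^+ 2 * a^-1).
  by rewrite -aaE; field; rewrite gt_eqF.
have a0 : 0 <= a^-1 by rewrite invr_ge0 ltW.
apply: ler_pM => //; first exact: mulr_ge0 (sqr_ge0 _) a0.
by rewrite ler_wpM2l// sqr_ge0.
Qed.

Lemma window_spacing_le : lam ^+ 2 < 2 -> M%:R * D ^+ 2 <= B ^+ 2 * A.
Proof.
move=> lam2; rewrite MD2E expRD BBE.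
have h1 : expR (2 * (E ^+ 2 - 1) / lam ^+ 2 * L) <= a.
  by rewrite ler_expR; move: E_exp; rewrite ler_norml => /andP[? ?].
have h2 : pi * lam ^+ 2 / L <= a.
  rewrite ler_pdivrMr// (@le_trans _ _ (a * 1))//; last first.
    by rewrite ler_wpM2l// ltW.
  by rewrite mulr1 (le_trans _ pi_le)// mulrC ler_pM2r// ltW.
apply: (@le_trans _ _ (a * (B ^+ 2 * a))); last by rewrite mulrCA aaE.
apply: ler_pM => //.
- by rewrite divr_ge0 ?(ltW L_gt0)// mulr_ge0// ltW.
- exact: mulr_ge0 (sqr_ge0 _) (expR_ge0 _).
- by rewrite ler_wpM2l// sqr_ge0.
Qed.

Hypothesis lam2_lt2 : lam ^+ 2 < 2.

(** The room comes from [1 < lam]: the required [2 * beta + 2 * eta <= 1] amounts to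
    [eta <= 1 - 1 / lam ^+ 2]. *)
Let D2_le : D ^+ 2 * A <= 1.
Proof.
rewrite -(ler_pM2l M_gt0) mulr1 mulrA.
apply: (@le_trans _ _ (B ^+ 2 * A * A)).
  by rewrite ler_pM2r// window_spacing_le.
rewrite -BBE /A -!expRD ME ler_expR -!mulrDl -[leRHS]mul1r ler_pM2r//.
by move: eta_lam; rewrite /beta => *; lra.
Qed.

Lemma window_width : D * (2 * t + 2) <= r.
Proof.
have t0 : 0 <= D * (2 * t + 2).
  by rewrite mulr_ge0 ?(ltW D_gt0)//; move: t_ge1 => *; lra.
rewrite -(ler_pXn2r (ltn0Sn 1)) ?nnegrE// ?(ltW r_gt0)//.
rewrite exprMn (le_trans (ler_wpM2l (sqr_ge0 D) A_ge_tr))//.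
by rewrite mulrCA ler_piMr// sqr_ge0.
Qed.

(** The power of 2 exceeds [M], and [M * D >= 1] because already [M * D ^+ 2 >= 1]. *)
Lemma window_scales : r <= D * 2 ^+ (trunc_log 2 M).+1.
Proof.
have M2 : M%:R <= 2 ^+ (trunc_log 2 M).+1 :> R.
  by rewrite -natrX ler_nat ltnW// trunc_log_ltn.
have B2A : 1 <= B ^+ 2 / A.
  rewrite ler_pdivlMr// mul1r -BBE ler_expR ler_pM2r//.
  by move: eta_beta eta_gt0 => *; lra.
have h : 1 <= M%:R * D ^+ 2 by rewrite (le_trans B2A)// window_spacing_ge.
have M1 : 1 <= M%:R :> R by rewrite ler1n ltnW.
have MD1 : 1 <= M%:R * D.
  have MD0 : 0 <= M%:R * D by rewrite mulr_ge0// ltW.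
  rewrite -(ler_pXn2r (ltn0Sn 1)) ?nnegrE// expr1n exprMn.
  by rewrite (le_trans h)// ler_wpM2r ?sqr_ge0// expr2 ler_peMr.
rewrite (@le_trans _ _ 1)//; first by move: r_le => *; lra.
by rewrite (le_trans MD1)// mulrC ler_wpM2l// ltW.
Qed.

Lemma window_depth : L / ln 2 + 2 <= A -> (trunc_log 2 M).+2%:R <= A.
Proof.
move=> h; have ln20 : 0 < ln (2 : R) by rewrite ln_gt0// ltr1n.
have : (trunc_log 2 M)%:R <= L / ln 2.
  rewrite ler_pdivlMr// mulr_natl -lnXn// ler_ln ?posrE ?exprn_gt0//.
  by rewrite -natrX ler_nat trunc_logP// ltnW.
rewrite -[(trunc_log 2 M).+2]addn2 natrD => *; lra.
Qed.

(** These choices make every failure probability of order at most [1 / A]: Chebyshev at [c] costs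
    [A ^- 2], Markov at [Q] costs [A * A / Q], and pairs within [delta] cost [delta * A ^+ 2]. *)
Let c := Num.sqrt M%:R * A.
Let m := M%:R * D ^+ 2 / 8.
Let delta := (A ^+ 3)^-1.
Let Q := A ^+ 3.
Let K1 := D * c + 4 * r * (M%:R * (D * s / k)) / k ^+ 2.
Let K2 := (2 * t + 3) / delta * Q.
Let S := 4 * M%:R * D ^+ 2 / r ^+ 2.

Let A20 : A ^+ 20 <= B.
Proof.
by rewrite /A -expRM_natl ler_expR mulrA ler_pM2r.
Qed.

Let A1 : 1 <= A. Proof. by move: A_ge64 => *; lra. Qed.

Let AX_le n p : (n <= p)%N -> A ^+ n <= A ^+ p.
Proof. by move=> np; rewrite ler_weXn2l. Qed.

Let c_sqr : c ^+ 2 = M%:R * A ^+ 2.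
Proof. by rewrite exprMn sqr_sqrtr// ltW. Qed.

Let Dc_le : D * c <= B * A ^+ 2.
Proof.
have Dc0 : 0 <= D * c.
  exact: mulr_ge0 (ltW D_gt0) (mulr_ge0 (sqrtr_ge0 _) (ltW A_gt0)).
have BA0 : 0 <= B * A ^+ 2 by rewrite mulr_ge0 ?sqr_ge0// ltW.
rewrite -(ler_pXn2r (ltn0Sn 1)) ?nnegrE// exprMn c_sqr.
have -> : D ^+ 2 * (M%:R * A ^+ 2) = M%:R * D ^+ 2 * A ^+ 2 by ring.
rewrite (le_trans (ler_wpM2r (sqr_ge0 A) (window_spacing_le lam2_lt2)))//.
rewrite exprMn -mulrA ler_wpM2l ?sqr_ge0// -exprS -exprM.
exact: AX_le.
Qed.

Let K1_le : K1 <= B * A ^+ 2 + A ^+ 2.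
Proof.
suff h : 4 * r * (M%:R * (D * s / k)) / k ^+ 2 <= A ^+ 2 by exact: lerD Dc_le h.
have r0 := ltW r_gt0; have L0 := ltW L_gt0.
have l1 : 1 <= lam ^+ 2 by rewrite exprn_ege1// ltW.
have -> : 4 * r * (M%:R * (D * s / k)) / k ^+ 2 =
    (8 * r) * (lam ^+ 2)^-1 * L * (M%:R * (D * s / k)).
  by rewrite window_kappa_sqr; field; rewrite !gt_eqF.
have aA : a <= A by rewrite -aaE ler_peMl ?(ltW a_gt0)// (le_trans L_ge1).
have q0 : 0 <= M%:R * (D * s / k).
  exact: mulr_ge0 (ltW M_gt0)
    (divr_ge0 (mulr_ge0 (ltW D_gt0) (expR_ge0 _)) (ltW k_gt0)).
rewrite expr2 ler_pM ?window_mass// ?mulr_ge0 ?invr_ge0 ?(ltW lam2_gt0)//.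
rewrite (le_trans _ (le_trans L_le aA))// ler_piMl//.
apply: mulr_ile1 => //; rewrite ?invr_ge0 ?(ltW lam2_gt0)//.
  by move: r_gt0 => *; lra.
by move: r_le => *; lra.
Qed.

Let K2E : K2 <= A ^+ 7.
Proof.
have -> : K2 = (2 * t + 3) * A ^+ 6.
  by rewrite /K2 /delta /Q invrK -mulrA -exprD.
by rewrite (exprS A 6) ler_pM2r// exprn_gt0.
Qed.

Let dm_ge : B ^+ 2 / (8 * A ^+ 4) <= delta * m.
Proof.
have -> : B ^+ 2 / (8 * A ^+ 4) = delta * (B ^+ 2 / A / 8).
  by rewrite /delta; field; rewrite gt_eqF.
rewrite /m ler_pM2l ?invr_gt0 ?exprn_gt0// ler_pM2r ?invr_gt0//.
exact: window_spacing_ge.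
Qed.

(** Noise of order [B * A ^+ 2] against a signal [B ^+ 2 / A ^+ 4]: it suffices that
    [24 * A ^+ 6 < B], which follows from [A ^+ 20 <= B]. *)
Lemma window_noise : K1 + K2 < delta * m.
Proof.
apply: (lt_le_trans _ dm_ge).
have B7 : A ^+ 7 <= B * A ^+ 2.
  rewrite (le_trans (AX_le 7 20 isT))// (le_trans A20)// ler_peMr ?(ltW B_gt0)//.
  by rewrite exprn_ege1.
have B1 : 1 <= B by rewrite (le_trans _ A20)// exprn_ege1.
have B2 : A ^+ 2 <= B * A ^+ 2 by rewrite ler_peMl ?sqr_ge0.
apply: (@le_lt_trans _ _ (3 * (B * A ^+ 2))).
  by have := K1_le; have := K2E => *; lra.
rewrite ltr_pdivlMr ?mulr_gt0 ?exprn_gt0//.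
have -> : 3 * (B * A ^+ 2) * (8 * A ^+ 4) = B * (24 * A ^+ 6) by ring.
rewrite (expr2 B) ltr_pM2l// (lt_le_trans _ A20)//.
rewrite (lt_le_trans _ (AX_le 7 20 isT))// (exprS A 6) ltr_pM2r ?exprn_gt0//.
by move: A_ge64 => *; lra.
Qed.

(** The numerator is at most [2 * B ^+ 2 * A ^+ 2] and [delta * m] at least [B ^+ 2 / (8 * A ^+ 4)].
    The resulting [128 * A ^+ 10 / B ^+ 2] is at most [1 / B], since [128 <= A ^+ 2] and
    [A ^+ 12 <= B]. *)
Lemma window_localized : 1 + (S + K2 ^+ 2) / (delta * m) ^+ 2 <= 1 + 1 / B.
Proof.
rewrite lerD2l.
have n0 : 0 <= S + K2 ^+ 2.
  by rewrite addr_ge0 ?sqr_ge0// divr_ge0 ?sqr_ge0// mulr_ge0 ?sqr_ge0// mulr_ge0// ltW.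
have S_le : S <= B ^+ 2 * A ^+ 2.
  have -> : S = M%:R * D ^+ 2 * (4 / r ^+ 2) by rewrite /S; field; rewrite gt_eqF.
  rewrite (expr2 A) mulrA; apply: ler_pM.
  - exact: mulr_ge0 (ltW M_gt0) (sqr_ge0 _).
  - by rewrite divr_ge0// sqr_ge0.
  - exact: window_spacing_le.
  - by rewrite ler_pdivrMr ?exprn_gt0// mulrC.
have K2_le : K2 ^+ 2 <= B ^+ 2 * A ^+ 2.
  have K20 : 0 <= K2.
    rewrite /K2 /delta invrK /Q !mulr_ge0 ?exprn_ge0 ?(ltW A_gt0)//.
    by move: t_ge1 => *; lra.
  rewrite (@le_trans _ _ (A ^+ 14))//.
    by rewrite (exprM A 7 2) lerXn2r ?nnegrE ?exprn_ge0 ?(ltW A_gt0).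
  rewrite (le_trans (AX_le 14 20 isT))// (le_trans A20)//.
  have B1 : 1 <= B by rewrite (le_trans _ A20)// exprn_ege1.
  by rewrite expr2 -mulrA ler_peMr ?(ltW B_gt0)// mulr_ege1// exprn_ege1.
have dm0 : 0 < B ^+ 2 / (8 * A ^+ 4) by rewrite divr_gt0 ?mulr_gt0 ?exprn_gt0.
have dm2 : (B ^+ 2 / (8 * A ^+ 4)) ^+ 2 <= (delta * m) ^+ 2.
  by rewrite lerXn2r ?nnegrE ?(ltW dm0)// (le_trans (ltW dm0)).
apply: (@le_trans _ _ ((2 * (B ^+ 2 * A ^+ 2)) / (B ^+ 2 / (8 * A ^+ 4)) ^+ 2)).
  rewrite ler_pM// ?invr_ge0 ?sqr_ge0//.
    by move: S_le K2_le => *; lra.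
  by rewrite lef_pV2 ?posrE ?exprn_gt0// (lt_le_trans dm0).
have -> : 2 * (B ^+ 2 * A ^+ 2) / (B ^+ 2 / (8 * A ^+ 4)) ^+ 2 =
    128 * A ^+ 10 / B / B by field; rewrite !gt_eqF.
rewrite ler_pM2r ?invr_gt0// ler_pdivrMr// mul1r (le_trans _ A20)//.
rewrite (le_trans _ (AX_le 12 20 isT))// (exprD A 2 10) ler_pM2r ?exprn_gt0//.
have := ler_pM _ _ A_ge64 A_ge64; rewrite -expr2 => H.
by rewrite (le_trans _ (H _ _))//; lra.
Qed.

(** [sqrt m] loses one power of [A] against [B], half of it in [window_spacing_ge] and half to beat
    the 8; [delta] costs three more. *)
Lemma window_delocalized : B / A ^+ 4 <= Num.sqrt m * delta.
Proof.
have -> : B / A ^+ 4 = B / A * delta by rewrite /delta; field; rewrite gt_eqF.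
rewrite ler_pM2r ?invr_gt0 ?exprn_gt0//.
have BA0 : 0 <= B / A by rewrite divr_ge0 ?(ltW B_gt0) ?(ltW A_gt0).
rewrite -[leLHS]ger0_norm// -sqrtr_sqr ler_wsqrtr// expr_div_n.
have := window_spacing_ge; rewrite /m ler_pdivrMr// => h.
have MD0 : 0 <= M%:R * D ^+ 2 by exact: mulr_ge0 (ltW M_gt0) (sqr_ge0 _).
apply: (@le_trans _ _ (M%:R * D ^+ 2 / A)).
  rewrite ler_pdivrMr ?exprn_gt0//.
  by have -> : M%:R * D ^+ 2 / A * A ^+ 2 = M%:R * D ^+ 2 * A by field; rewrite gt_eqF.
rewrite ler_wpM2l// lef_pV2 ?posrE//.
by move: A_ge64 => *; lra.
Qed.

Lemma window_probability (J : nat) (tl : R) : J.+1%:R <= A ->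
  4 * M%:R / (r ^+ 2 * c ^+ 2) + 2 * tl
    + 4 * J.+1%:R * (M%:R * (D * s / k)) / Q
    + 4 * delta * (M%:R * (D * s / k))
    + 4 * (t + 1) * delta * (M%:R * (D * s / k)) ^+ 2 <=
  (4 / r ^+ 2 + 12 + 4 * t) / A + 2 * tl.
Proof.
move=> JA; have q_le := window_mass.
have q0 : 0 <= M%:R * (D * s / k).
  exact: mulr_ge0 (ltW M_gt0)
    (divr_ge0 (mulr_ge0 (ltW D_gt0) (expR_ge0 _)) (ltW k_gt0)).
set q := M%:R * _ in q_le q0 *.
have AV0 : 0 <= A^-1 by rewrite invr_ge0 ltW.
have AV1 : A^-1 <= 1 by rewrite invf_le1.
have p1 : 4 * M%:R / (r ^+ 2 * c ^+ 2) <= 4 / r ^+ 2 / A.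
  rewrite c_sqr.
  have -> : 4 * M%:R / (r ^+ 2 * (M%:R * A ^+ 2)) = 4 / r ^+ 2 / A * A^-1.
    by field; rewrite !gt_eqF.
  by rewrite ler_piMr// divr_ge0 ?divr_ge0 ?sqr_ge0// ltW.
have p2 : 4 * J.+1%:R * q / Q <= 4 / A.
  rewrite ler_pdivrMr ?exprn_gt0//.
  have -> : 4 / A * A ^+ 3 = 4 * A * A by field; rewrite gt_eqF.
  by rewrite ler_pM// ?mulr_ge0// ler_pM2l.
have dq : delta * q <= A^-1 * A^-1.
  have -> : A^-1 * A^-1 = delta * A by rewrite /delta; field; rewrite gt_eqF.
  by rewrite ler_pM2l// invr_gt0 exprn_gt0.
have p3 : 4 * delta * q <= 4 / A.
  rewrite -mulrA ler_pM2l// (le_trans dq)// ler_piMr//.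
have p4 : 4 * (t + 1) * delta * q ^+ 2 <= 4 * (t + 1) / A.
  have t0 : 0 <= 4 * (t + 1) by move: t_ge1 => *; lra.
  rewrite -mulrA ler_wpM2l// expr2 mulrA (le_trans (ler_wpM2r q0 dq))//.
  by rewrite -mulrA ler_piMr// mulrC ler_pdivrMr// mul1r.
have -> : (4 / r ^+ 2 + 12 + 4 * t) / A =
    4 / r ^+ 2 / A + 4 / A + 4 / A + 4 * (t + 1) / A by ring.
lra.
Qed.

End WindowEstimates.

(** * Asymptotics *)

Section Asymptotics.
Context {R : realType}.
Local Notation Rm := (measurableTypeR R).
Local Notation gauss := (@normal_prob R 0 1).

Lemma near_ln_ge (c : R) : \forall M \near \oo, c <= ln (M%:R : R).
Proof.
have := @cvgr_idn R => /cvgry_ge/(_ (expR c)).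
apply: filterS => M cM; rewrite -[c]expRK ler_ln ?posrE ?expR_gt0//.
exact: lt_le_trans (expR_gt0 _) cM.
Qed.

Lemma near_expR_ge (eta c : R) : 0 < eta ->
  \forall M \near \oo, c * ln (M%:R : R) + c <= expR (eta * ln M%:R).
Proof.
move=> eta0; near=> M.
have L1 : 1 <= ln (M%:R : R) by near: M; exact: near_ln_ge.
(* With [x = eta * L / 2], [exp (2 * x) >= x ^+ 2 = eta ^+ 2 * L ^+ 2 / 4]; this threshold makes it
   at least [2 * |c| * L], one [|c| * L] for each summand. *)
have Lc : 8 * `|c| / eta ^+ 2 <= ln (M%:R : R) by near: M; exact: near_ln_ge.
move: L1 Lc; set L := ln _ => L1 Lc.
have -> : eta * L = 2%:R * (eta * L / 2) by field.
rewrite expRM_natl.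
have x0 : 0 <= eta * L / 2 by rewrite divr_ge0// mulr_ge0// ?ltW//; lra.
have h1 : (eta * L / 2) ^+ 2 <= expR (eta * L / 2) ^+ 2.
  rewrite lerXn2r ?nnegrE ?expR_ge0//.
  by have := expR_ge1Dx (eta * L / 2) => *; lra.
apply: (le_trans _ h1).
have h2 : 8 * `|c| <= L * eta ^+ 2 by rewrite -ler_pdivrMr// exprn_gt0.
have L0 : 0 <= L by lra.
have h3 := ler_wpM2r L0 h2.
have -> : (eta * L / 2) ^+ 2 = L * eta ^+ 2 * L / 4 by field.
have h4 : c * L <= `|c| * L by rewrite ler_wpM2r// ler_norm.
have h5 : c <= `|c| * L.
  by rewrite (le_trans (ler_norm _))// ler_peMr.
lra.
Unshelve. all: by end_near. Qed.

Lemma near_expR_ge_cst (eta c : R) : 0 < eta ->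
  \forall M \near \oo, c <= expR (eta * ln (M%:R : R)).
Proof.
move=> eta0; near=> M.
have L1 : 1 <= ln (M%:R : R) by near: M; exact: near_ln_ge.
have h : `|c| * ln (M%:R : R) + `|c| <= expR (eta * ln M%:R).
  by near: M; exact: near_expR_ge.
rewrite (le_trans _ h)// (le_trans (ler_norm c))// lerDr mulr_ge0//.
by lra.
Unshelve. all: by end_near. Qed.

Lemma div_expR_cvg0 (eta c : R) : 0 < eta ->
  c / expR (eta * ln (M%:R : R)) @[M --> \oo] --> (0 : R).
Proof.
move=> eta0; apply/cvgrPdist_le => eps eps0; near=> M.
rewrite sub0r normrN normrM normfV (gtr0_norm (expR_gt0 _)).
rewrite ler_pdivrMr ?expR_gt0// -ler_pdivrMl//.
by near: M; exact: near_expR_ge_cst.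
Unshelve. all: by end_near. Qed.

(** [kappa] tends to 0, so the set is eventually inside each [F n]; continuity from above along the
    [F n] concludes. *)
Lemma gauss_tail_cvg0 (lam : R) : 0 < lam ->
  fine (gauss [set v : Rm | 2^-1 < `|kappa lam M * v|]) @[M --> \oo] --> (0 : R).
Proof.
move=> lam0; pose F (n : nat) := [set v : Rm | n%:R < `|v|].
have mabs : measurable_fun [set: Rm] (fun v : R => `|v|).
  exact: measurableT_comp.
have mF n : measurable (F n).
  by apply: measurable_holds; exact: measurable_fun_ltr.
have F0 : \bigcap_n F n = set0.
  apply/seteqP; split => // v /(_ (Num.truncn `|v|).+1 Logic.I); rewrite /F/=.
  by rewrite ltNge (ltW (truncnS_gt _)).
have := @nonincreasing_cvg_mu _ _ _ gauss F.
rewrite F0 measure0 => /(_ _ _ _ _)/wrap[||||cF].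
- by rewrite (le_lt_trans (probability_le1 gauss (mF 0%N)))// ltry.
- exact: mF.
- exact: measurable0.
- move=> n p np; apply/subsetPset => v; rewrite /F/=; apply: le_lt_trans.
  by rewrite ler_nat.
move/fine_cvgP : cF => [_ cF]; apply/cvgrPdist_le => eps eps0.
have /cvgrPdist_le/(_ _ eps0)[n _ nF] := cF.
near=> M.
have L1 : 1 <= ln (M%:R : R) by near: M; exact: near_ln_ge.
have Ln : (2 * n.+1%:R * lam) ^+ 2 <= 2 * ln (M%:R : R).
  have : (2 * n.+1%:R * lam) ^+ 2 / 2 <= ln (M%:R : R).
    by near: M; exact: near_ln_ge.
  by move=> *; lra.
have sq0 : 0 < Num.sqrt (2 * ln (M%:R : R)) by rewrite sqrtr_gt0; lra.
have k0 : 0 < kappa lam M by rewrite divr_gt0.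
have k_le : kappa lam M * n.+1%:R <= 2^-1.
  rewrite /kappa mulrAC ler_pdivrMr// mulrC -ler_pdivrMl ?invr_gt0// invrK mulrA.
  have h0 : 0 <= 2 * n.+1%:R * lam by rewrite !mulr_ge0// ltW.
  rewrite (_ : 2 * n.+1%:R * lam = Num.sqrt ((2 * n.+1%:R * lam) ^+ 2)).
    by rewrite ler_wsqrtr.
  by rewrite sqrtr_sqr ger0_norm.
have mT : measurable [set v : Rm | 2^-1 < `|kappa lam M * v|].
  apply: measurable_holds; apply: measurable_fun_ltr => //.
  by apply: measurableT_comp => //; exact: measurable_funM.
have sub : [set v : Rm | 2^-1 < `|kappa lam M * v|] `<=` F n.
  move=> v; rewrite /F/= normrM (gtr0_norm k0) => h.
  have := le_lt_trans k_le h; rewrite ltr_pM2l//.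
  by apply: le_lt_trans; rewrite ler_nat.
have := nF n (leqnn n); rewrite /= !sub0r !normrN => h.
rewrite (le_trans _ h)// !ger0_norm ?fine_ge0//.
rewrite fine_le ?fin_num_measure//.
by apply: le_measure; rewrite ?inE.
Unshelve. all: by end_near. Qed.

End Asymptotics.

(** Only the bad set has to be measurable: its complement competes in the supremum defining
    [inner_prob]. *)
Lemma whp_of_bad (R : realType) (d : nat -> measure_display)
    (T : forall M, measurableType (d M)) (P : forall M, probability (T M) R)
    (G : forall M, set (T M)) (p : nat -> R) :
  p M @[M --> \oo] --> (0 : R) ->
  (\forall M \near \oo, exists2 B : set (T M),
     measurable B /\ (P M B <= (p M)%:E)%E & forall w, ~ B w -> G M w) ->
  whp P G.
Proof.
move=> p0 nG; rewrite /whp.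
apply: (@squeeze_cvge _ _ _ _ (fun M => (1 - p M)%:E) _ (fun=> 1%E)).
- apply: filterS nG => M [B [mB PB] BG]; apply/andP; split.
    apply: (@le_trans _ _ (P M (~` B))).
      by rewrite probability_setC// EFinB leeB.
    apply: ereal_sup_ubound; exists (~` B) => //; split => //.
    exact: measurableC.
  by apply: ge_ereal_sup => _ [C [mC _] <-]; exact: probability_le1.
- apply/fine_cvgP; split; first by near=> M.
  rewrite -[X in _ --> X]subr0; apply: cvgB => //; exact: cvg_cst.
- exact: cvg_cst.
Unshelve. all: by end_near. Qed.

(** For fixed [s] the label is, up to the shift by 1, a finite sum of differences of indicators of
    measurable events. *)
Lemma measurable_label (R : realType) (d : measure_display) (T : measurableType d)
    (P : probability T R) (M : nat) (X : 'I_M -> {RV P >-> R}) (lam E s : R) (k : int) :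
  measurable [set w | label_at lam M E (fun x => X x w) s = k].
Proof.
pose A := [set v : R | (kappa lam M * v - E) / Delta lam M E < s].
pose B := [set v : R | (kappa lam M * v - E) / Delta lam M E <= 0].
pose f w : R := \sum_x (\1_A (X x w) - \1_B (X x w)).
have m_om : measurable_fun [set: R]
    (fun v : R => (kappa lam M * v - E) / Delta lam M E).
  apply: measurable_funM; last exact: measurable_cst.
  apply: measurable_funB; last exact: measurable_cst.
  by apply: measurable_funM; [exact: measurable_cst|exact: measurable_id].
have mA : measurable A by apply: measurable_holds; exact: measurable_fun_ltr.
have mB : measurable B by apply: measurable_holds; exact: measurable_fun_ler.
have mf : measurable_fun setT f.
  apply: measurable_sum => x; apply: measurable_funB;
    apply: measurableT_comp => //; exact: measurable_indic.
have fE w : f w = (label_at lam M E (fun x => X x w) s - 1)%:~R.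
  rewrite /label_at addrK intrB /f sumrB /count_below /count_nonpos.
  rewrite -!sum1_count !big_enum_cond/= -!pmulrn !natr_sum.
  congr (_ - _); rewrite [RHS]big_mkcond/=; apply: eq_bigr => x _; rewrite indicE.
    have -> : (X x w \in A) = (site_omega lam E (fun x => X x w) x < s).
      by apply/idP/idP; rewrite inE.
    by case: ifP.
  have -> : (X x w \in B) = (site_omega lam E (fun x => X x w) x <= 0).
    by apply/idP/idP; rewrite inE.
  by case: ifP.
rewrite (_ : [set w | _] = [set w | f w == (k - 1)%:~R]).
  by apply: measurable_holds; exact: measurable_fun_eqr.
apply/seteqP; split => w /=; rewrite fE; first by move=> ->.
by move=> /eqP/intr_inj/addIr.
Qed.

(** * The good event along the sequence of windows *)

Section GoodWindow.
Context (R : realType) (lam : R) (d : nat -> measure_display)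
  (T : forall M : nat, measurableType (d M))
  (P : forall M : nat, probability (T M) R)
  (V : forall M : nat, 'I_M -> {RV (P M) >-> R}) (E Ehat : nat -> R).
Arguments V : clear implicits.
Hypotheses (hlam1 : 1 < lam) (hlam2 : lam < Num.sqrt 2).
Hypothesis hV : forall M : nat, (2 <= M)%N -> iid_std_gaussian (V M).
Hypothesis hE : E M @[M --> \oo] --> (-1 : R).
Hypothesis hEhat : reference_energy lam Ehat.
Let beta := 1 / lam ^+ 2 - 1 / 2.
Let tauM M := (Ehat M - E M) / Delta lam M (E M).
Let pot M (w : T M) (x : 'I_M) : R := V M x w.
Let nM M (w : T M) : int := label_at lam M (E M) (pot M w) (tauM M).

Let lam2_lt2 : lam ^+ 2 < 2.
Proof.
have l0 : 0 <= lam by rewrite ltW// (lt_trans _ hlam1).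
by rewrite -[ltRHS]sqr_sqrtr// ltr_pXn2r ?nnegrE ?sqrtr_ge0.
Qed.

Lemma window_exponent_gt0 : 0 < beta.
Proof.
have l2 : 0 < lam ^+ 2 by rewrite exprn_gt0// (lt_trans _ hlam1).
by rewrite subr_gt0 !div1r ltf_pV2 ?posrE.
Qed.

Lemma near_good_event (eta t : R) : 0 < eta -> 20 * eta <= beta ->
  eta <= 1 - 1 / lam ^+ 2 -> 1 <= t ->
  exists2 p : nat -> R, p M @[M --> \oo] --> (0 : R) &
  \forall M \near \oo, exists2 B : set (T M),
    measurable B /\ (P M B <= (p M)%:E)%E &
    forall w, ~ B w ->
      [/\ labelled lam (E M) (pot M w) (nM M w),
          `|eig lam (E M) (pot M w) (nM M w) - tauM M| <=
            (expR (eta * ln M%:R) ^+ 3)^-1,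
          expR (beta * ln M%:R) / expR (eta * ln M%:R) ^+ 4 <=
            norm_ratio lam (E M) (pot M w) (nM M w) &
          forall n, n <> nM M w -> labelled lam (E M) (pot M w) n ->
            `|eig lam (E M) (pot M w) n| + `|tauM M| <= t ->
            norm_ratio lam (E M) (pot M w) n <= 1 + 1 / expR (beta * ln M%:R)].
Proof.
move=> eta0 eta_beta eta_lam t1.
have lam0 : 0 < lam by rewrite (lt_trans _ hlam1).
have eta1 : eta <= 1.
  rewrite (le_trans eta_lam)// lerBlDr lerDl divr_ge0//.
  by rewrite exprn_ge0// ltW.
(* [8^-1] serves the deterministic analysis; [eta / 6] keeps [s] within a factor [M ^ (eta / 2)] of
   the Gaussian exponential at [E]. *)
pose r := Num.min 8^-1 (eta / 6).
have r0 : 0 < r by rewrite lt_min; apply/andP; split; [rewrite invr_gt0|rewrite divr_gt0].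
have r_le : r <= 8^-1 by rewrite ge_min lexx.
have r_eta : 6 * r <= eta.
  have : r <= eta / 6 by rewrite ge_min lexx orbT.
  by move=> *; lra.
have eta2 : 0 < eta / 2 by rewrite divr_gt0.
(* Tolerance for [E] and [Ehat] around [-1]: it makes [E ^+ 2 - (- Ehat - r) ^+ 2] at most
   [7 / 5 * r * 2 <= 3 * r]. *)
have r50 : 0 < r / 5 by rewrite divr_gt0.
have r20 : 0 < r ^+ 2 by rewrite exprn_gt0.
pose tl M := fine (@normal_prob R 0 1
  [set v : measurableTypeR R | 2^-1 < `|kappa lam M * v|]).
exists (fun M => (4 / r ^+ 2 + 12 + 4 * t) / expR (eta * ln M%:R) + 2 * tl M).
  rewrite -[X in _ --> X]addr0 -[X in _ --> _ + X](mulr0 2).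
  apply: cvgD; first exact: div_expR_cvg0.
  by apply: cvgM; [exact: cvg_cst|exact: gauss_tail_cvg0].
case: hEhat => Ehat1 cEhat.
have /cvgrPdist_le/(_ _ r50) nE := hE.
have /cvgrPdist_le/(_ _ r50) ne := cEhat.
near=> M.
have M2 : (2 <= M)%N by near: M; exact: nbhs_infty_ge.
have L1 : 1 <= ln (M%:R : R) by near: M; exact: near_ln_ge.
have La : ln (M%:R : R) <= expR (eta / 2 * ln M%:R).
  have : 1 * ln (M%:R : R) + 1 <= expR (eta / 2 * ln M%:R).
    by near: M; exact: near_expR_ge.
  by move=> *; lra.
have pia : 2 * pi <= expR (eta / 2 * ln (M%:R : R)).
  by near: M; exact: near_expR_ge_cst.
have A64 : 64 <= expR (eta * ln (M%:R : R)).
  by near: M; exact: near_expR_ge_cst.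
have At : 2 * t + 3 <= expR (eta * ln (M%:R : R)).
  by near: M; exact: near_expR_ge_cst.
have Atr : (2 * t + 2) ^+ 2 <= r ^+ 2 * expR (eta * ln (M%:R : R)).
  by rewrite -ler_pdivrMl//; near: M; exact: near_expR_ge_cst.
have Ar : 4 <= r ^+ 2 * expR (eta * ln (M%:R : R)).
  by rewrite -ler_pdivrMl//; near: M; exact: near_expR_ge_cst.
have Ad : ln (M%:R : R) / ln 2 + 2 <= expR (eta * ln M%:R).
  have h : ((ln 2)^-1 + 2) * ln (M%:R : R) + ((ln 2)^-1 + 2) <= expR (eta * ln M%:R).
    by near: M; exact: near_expR_ge.
  have ln20 : 0 < (ln (2 : R))^-1 by rewrite invr_gt0 ln_gt0// ltr1n.
  rewrite (le_trans _ h)// mulrDl [ln _ / _]mulrC.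
  by lra.
have En : `|- 1 - E M| <= r / 5 by near: M.
have en : `|- 1 - Ehat M| <= r / 5 by near: M.
have rh : rho_hat lam M (Ehat M) = 1 by near: M.
move: En en; rewrite !ler_norml => /andP[E1 E2] /andP[e1 e2].
have En2 : `|E M ^+ 2 - 1| <= eta / 4.
  have -> : E M ^+ 2 - 1 = (- 1 - E M) * (1 - E M) by ring.
  rewrite normrM (@le_trans _ _ (r / 5 * 3))//; last by lra.
  by apply: ler_pM => //; rewrite ler_norml; apply/andP; split; lra.
have en4 : `|Ehat M + 1| <= 4^-1.
  by rewrite ler_norml; apply/andP; split; lra.
have Een : E M ^+ 2 - (- Ehat M - r) ^+ 2 <= 3 * r.
  have -> : E M ^+ 2 - (- Ehat M - r) ^+ 2 =
    (- E M - (- Ehat M - r)) * (- E M + (- Ehat M - r)) by ring.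
  have h1 : `|- E M - (- Ehat M - r)| <= 7 / 5 * r.
    by rewrite ler_norml; apply/andP; split; lra.
  have h2 : `|- E M + (- Ehat M - r)| <= 2.
    by rewrite ler_norml; apply/andP; split; lra.
  have := ler_pM (normr_ge0 _) (normr_ge0 _) h1 h2; rewrite -normrM => h.
  by rewrite (le_trans (ler_norm _))// (le_trans h)//; lra.
have lam2 := lam2_lt2.
have k0 := window_kappa_gt0 lam M hlam1 L1.
have D0 := window_Delta_gt0 lam M (E M) hlam1 M2 L1.
have dens := window_density lam M (Ehat M) r hlam1 r_le en4 L1.
have width := window_width lam M (E M) eta r t hlam1 M2 eta_lam r0 t1 En2 L1 pia Atr lam2.
have scales := window_scales lam M (E M) eta r hlam1 M2 eta0 eta_beta r_le En2 L1 La.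
have depth := window_depth M eta M2 Ad.
have noise := window_noise lam M (E M) (Ehat M) eta r t hlam1 M2 eta0 eta_beta r0
  r_le r_eta En2 Een L1 La pia A64 At lam2.
have localized := window_localized lam M (E M) eta r t hlam1 M2 eta_beta r0 t1 En2
  L1 La pia A64 At Ar lam2.
have delocalized := window_delocalized lam M (E M) eta hlam1 M2 En2 L1 La A64.
have prob := window_probability lam M (E M) (Ehat M) eta r t hlam1 M2 eta0 r0 r_eta
  t1 Een L1 pia A64 _ (tl M) depth.
have M0 : (0 < M)%N by exact: ltnW.
have A0 : 0 < expR (eta * ln (M%:R : R)) by exact: expR_gt0.
have Q0 : 0 < expR (eta * ln (M%:R : R)) ^+ 3 by rewrite exprn_gt0.
have delta0 : 0 < (expR (eta * ln (M%:R : R)) ^+ 3)^-1 by rewrite invr_gt0.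
have delta1 : (expR (eta * ln (M%:R : R)) ^+ 3)^-1 <= 1.
  by rewrite invf_le1// exprn_ege1//; lra.
have c0 : 0 < Num.sqrt M%:R * expR (eta * ln (M%:R : R)).
  by rewrite mulr_gt0// sqrtr_gt0 ltr0n.
have [B [mB PB] hB] := good_event _ (P M) M (V M) lam (E M) (Ehat M) r
  (expR (- ((- Ehat M - r) ^+ 2 / lam ^+ 2 * ln M%:R))) t _ _ _
  (trunc_log 2 M).+1 (hV M M2) M0 k0 D0 r0 r_le en4 (expR_ge0 _) dens rh
  delta0 delta1 t1 width scales Q0 c0 noise.
exists B.
  by split => //; rewrite (le_trans PB)// lee_fin.
move=> w /hB[l1 l2 l3 l4]; split => //.
  exact: le_trans delocalized l3.
by move=> n nn ln tn; rewrite (le_trans (l4 n nn ln tn)).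
Unshelve. all: by end_near. Qed.

(** One constraint for each use of [eta]: noise below signal, a shrinking window, and the loss
    [A ^+ 4] below [M ^ gamma]. *)
Lemma window_rate_exists (gamma : R) : 0 < gamma ->
  exists eta, [/\ 0 < eta, 20 * eta <= beta, eta <= 1 - 1 / lam ^+ 2 &
    4 * eta <= gamma].
Proof.
move=> g0; have b0 := window_exponent_gt0.
have l0 : 0 < 1 - 1 / lam ^+ 2.
  by rewrite subr_gt0 div1r invf_lt1 ?exprn_egt1// exprn_gt0// (lt_trans _ hlam1).
pose eta := Num.min (Num.min (beta / 20) (1 - 1 / lam ^+ 2)) (gamma / 4).
have h1 : eta <= beta / 20 by rewrite !ge_min lexx.
have h2 : eta <= 1 - 1 / lam ^+ 2 by rewrite !ge_min lexx orbT.
have h3 : eta <= gamma / 4 by rewrite !ge_min lexx orbT.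
exists eta; split=> //; [|lra|lra].
by rewrite !lt_min l0 !divr_gt0.
Qed.

End GoodWindow.

Theorem theorem6p4 (R : realType) (lam : R)
  (hlam1 : 1 < lam) (hlam2 : lam < Num.sqrt 2)
  (d : nat -> measure_display) (T : forall M : nat, measurableType (d M))
  (P : forall M : nat, probability (T M) R)
  (V : forall M : nat, 'I_M -> {RV (P M) >-> R})
  (hV : forall M : nat, (2 <= M)%N -> iid_std_gaussian (V M))
  (E : nat -> R) (hE : E M @[M --> \oo] --> (-1 : R))
  (Ehat : nat -> R) (hEhat : reference_energy lam Ehat)
  (tau : R)
  (htau : (Ehat M - E M) / Delta lam M (E M) @[M --> \oo] --> tau) :
  let pot := fun (M : nat) (w : T M) (x : 'I_M) => V M x w in
  exists nM : forall M : nat, T M -> int,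
    [/\ (forall (M : nat) (k : int), measurable [set w : T M | nM M w = k]),
        whp P (fun M => [set w | labelled lam (E M) (pot M w) (nM M w)]),
        (forall eps : R, 0 < eps ->
           whp P (fun M => [set w |
             `|eig lam (E M) (pot M w) (nM M w) - tau| < eps])),
        (forall gamma : R, 0 < gamma ->
           whp P (fun M => [set w |
             M%:R `^ (1 / lam ^+ 2 - 1 / 2 - gamma) <=
             norm_ratio lam (E M) (pot M w) (nM M w)]))
      & (forall W gamma : R, 0 < gamma ->
           whp P (fun M => [set w | forall n : int, n <> nM M w ->
             labelled lam (E M) (pot M w) n ->
             `|eig lam (E M) (pot M w) n| < W ->
             norm_ratio lam (E M) (pot M w) n <=
             1 + 1 / M%:R `^ (1 / lam ^+ 2 - 1 / 2 - gamma)]))].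
Proof.
move=> pot.
pose tauM M := (Ehat M - E M) / Delta lam M (E M).
pose beta := 1 / lam ^+ 2 - 1 / 2.
have good := near_good_event R lam d T P V E Ehat hlam1 hlam2 hV hE hEhat.
have rate := window_rate_exists R lam hlam1 hlam2.
have powE M (x : R) : (0 < M)%N -> M%:R `^ x = expR (x * ln M%:R).
  by move=> M0; rewrite /powR gt_eqF ?ltr0n.
have M1 : \forall M \near \oo, (0 < M)%N by exact: nbhs_infty_gt.
have lnM : \forall M \near \oo, 0 <= ln (M%:R : R) by exact: near_ln_ge.
(* The index depends on the potential only through counts at deterministic points and is defined
   even where no eigenvalue carries it. *)
exists (fun M w => label_at lam M (E M) (pot M w) (tauM M)); split.
- by move=> M k; exact: measurable_label.
- have [eta [eta0 h1 h2 _]] := rate 1 ltr01.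
  have [p p0 np] := good eta 1 eta0 h1 h2 (lexx 1).
  apply: (whp_of_bad _ _ _ _ _ _ p0); apply: filterS np => M [B mB hB].
  by exists B => // w /hB[].
- move=> eps eps0; have [eta [eta0 h1 h2 _]] := rate 1 ltr01.
  have [p p0 np] := good eta 1 eta0 h1 h2 (lexx 1).
  have e3 : 0 < eps / 3 by rewrite divr_gt0.
  have /cvgrPdist_le/(_ _ e3) nt := htau.
  (* [1 <= A] gives [A <= A ^+ 3], and [3 / eps <= A] then gives [delta <= eps / 3]; another
     [eps / 3] comes from the convergence of [tauM]. *)
  have nA := near_expR_ge_cst _ (1 + 3 / eps) eta0.
  apply: (whp_of_bad _ _ _ _ _ _ p0).
  apply: filterS3 np nt nA => M [B mB hB] tM AM; exists B => // w /hB[_ et _ _].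
  have A1 : 1 <= expR (eta * ln (M%:R : R)).
    by rewrite (le_trans _ AM)// lerDl divr_ge0// ltW.
  have A3 : (expR (eta * ln (M%:R : R)) ^+ 3)^-1 <= eps / 3.
    rewrite -[leRHS]invrK lef_pV2 ?posrE ?invr_gt0 ?exprn_gt0 ?expR_gt0//.
    rewrite invf_div (@le_trans _ _ (expR (eta * ln (M%:R : R))))//.
      by rewrite (le_trans _ AM)// lerDr.
    by rewrite -[leLHS]expr1 ler_weXn2l.
  set u := eig _ _ _ _ in et *; rewrite /=.
  have -> : u - tau = (u - tauM M) + - (tau - tauM M) by ring.
  rewrite (le_lt_trans (ler_normD _ _))// normrN.
  by move: (le_trans et A3) tM => *; rewrite /tauM in et *; lra.
- move=> gamma gamma0; have [eta [eta0 h1 h2 h4]] := rate gamma gamma0.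
  have [p p0 np] := good eta 1 eta0 h1 h2 (lexx 1).
  apply: (whp_of_bad _ _ _ _ _ _ p0).
  apply: filterS3 np M1 lnM => M [B mB hB] M0 L0; exists B => // w /hB[_ _ + _].
  (* [B / A ^+ 4 = M ^ (beta - 4 * eta)], and [4 * eta <= gamma]. *)
  apply: le_trans; rewrite powE// -expRM_natl -expRB ler_expR.
  by rewrite mulrA -mulrBl ler_wpM2r//; lra.
- move=> W gamma gamma0; have [eta [eta0 h1 h2 h4]] := rate gamma gamma0.
  (* Eventually [|tauM| <= |tau| + 1], so this half-width covers [|u| + |tauM|] whenever [|u| < W];
     the added constant also ensures that it is at least 1. *)
  have t1 : 1 <= `|W| + `|tau| + 2.
    by have := normr_ge0 W; have := normr_ge0 tau => *; lra.
  have [p p0 np] := good eta _ eta0 h1 h2 t1.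
  have /cvgrPdist_le/(_ _ ltr01) nt := htau.
  apply: (whp_of_bad _ _ _ _ _ _ p0).
  have nt' : \forall M \near \oo, `|tau - tauM M| <= 1 /\ (0 < M)%N.
    exact: filterI.
  apply: filterS3 np nt' lnM => M [B mB hB] [tM M0] L0; exists B => // w.
  move=> /hB[_ _ _ loc] n nn ln nW; apply: (le_trans (loc n nn ln _)).
    have := ler_normB tau (tau - tauM M); rewrite subKr.
    by have := ler_norm W => *; lra.
  rewrite lerD2l powE// !div1r lef_pV2 ?posrE ?expR_gt0// ler_expR.
  by rewrite ler_wpM2r//; lra.
Qed.
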